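(* Let $H$ be a Hilbert space, $\mathbf{a}=[a_1,\dots,a_\ell]$ a row and $\mathbf{b}=[b_1,\dots,b_\ell]^t$ a column of operators in $\mathcal{B}(H)$, and $Tx=\sum_{j=1}^\ell a_jxb_j$. Let $H_1=\{\xi\in H:\|\xi\|\le1\}$ and define $f_T\colon H_1\times H_1\to\mathbb{C}$ by $f_T(\xi,\eta)=\operatorname{tgm}(Q(\mathbf{a}^*,\xi),Q(\mathbf{b},\eta))$. The following are equivalent: (i) $T\colon\mathcal{B}(H)\to\mathcal{B}(H)$ is compact; (ii) $f_T$ is continuous on $H_1\times H_1$ with respect to the product of the weak topologies; (iii) $f_T$ is continuous, with respect to the product of the weak topologies on $H_1\times H_1$, at each point of $(H_1\times\{0\})\cup(\{0\}\times H_1)$. If moreover $a_1,\dots,a_\ell$ are linearly independent and $b_1,\dots,b_\ell$ are linearly independent, then (i)–(iii) are also equivalent to (iv) $a_j,b_j\in\mathcal{K}(H)$ for $1\le j\le\ell$.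
   Context: $\mathcal{K}(H)$ denotes the compact operators on $H$. For a column $\mathbf{c}=[c_1,\dots,c_\ell]^t$ of operators and $\eta\in H$, $Q(\mathbf{c},\eta)=(\langle c_j\eta,c_i\eta\rangle)_{i,j=1}^\ell$; $\mathbf{a}^*=[a_1^*,\dots,a_\ell^*]^t$. For positive semidefinite $X,Y\in M_\ell(\mathbb{C})$, $\operatorname{tgm}(X,Y)=\operatorname{trace}\sqrt{\sqrt{X}Y\sqrt{X}}$. *)

(* Defs.v *)
(* abstract complex Hilbert space over C = R[i], R : realType. *)
From mathcomp Require Import all_boot all_algebra.
From mathcomp Require Import reals.
From mathcomp.real_closed Require Import complex.
From Stdlib Require Import ClassicalEpsilon.
Set Implicit Arguments. Unset Strict Implicit. Unset Printing Implicit Defensive.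
Import GRing.Theory Num.Theory.
Local Open Scope ring_scope.
Local Open Scope complex_scope.

(* A complex Hilbert space: a C-vector space with an inner product, linear in
   the first variable, conjugate symmetric, positive definite, and complete
   for the induced norm. *)
Record hilbert (R : realType) := Hilbert {
  hsort :> lmodType R[i];
  hinner : hsort -> hsort -> R[i];
  hinnerDl : forall (a : R[i]) (x y z : hsort),
      hinner (a *: x + y) z = a * hinner x z + hinner y z;
  hinnerC : forall x y : hsort, hinner y x = (hinner x y)^*;
  hinner_ge0 : forall x : hsort, 0 <= hinner x x;
  hinner_eq0 : forall x : hsort, hinner x x = 0 -> x = 0;
  hcomplete : forall u : nat -> hsort,
      (forall e : R[i], 0 < e -> exists N : nat, forall m n : nat,
          (N <= m)%N -> (N <= n)%N ->
          sqrtC (hinner (u m - u n) (u m - u n)) < e) ->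
      exists x : hsort, forall e : R[i], 0 < e -> exists N : nat,
          forall n : nat, (N <= n)%N -> sqrtC (hinner (u n - x) (u n - x)) < e
}.

Section Defs.
Variable R : realType.
Variable H : hilbert R.
Local Notation C := (R[i]).

Definition hnorm (x : H) : C := sqrtC (hinner x x).

(* "g has operator norm <= c" *)
Definition opnorm_le (g : H -> H) (c : C) : Prop :=
  forall x : H, hnorm (g x) <= c * hnorm x.

(* g is an element of B(H): a bounded linear operator *)
Definition is_bop (g : H -> H) : Prop :=
  (forall (a : C) (x y : H), g (a *: x + y) = a *: g x + g y) /\
  exists M : C, opnorm_le g M.

(* Hilbert-space adjoint (exists for bounded operators by Riesz) *)
Definition adj (g : H -> H) : H -> H :=
  epsilon (inhabits g) (fun g' => forall x y : H, hinner (g x) y = hinner x (g' y)).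

(* g is a compact operator on H, i.e. g \in K(H) *)
Definition is_compact_op (g : H -> H) : Prop :=
  is_bop g /\
  forall x : nat -> H, (forall n, hnorm (x n) <= 1) ->
    exists (phi : nat -> nat) (y : H), (forall n, (phi n < phi n.+1)%N) /\
      forall e : C, 0 < e -> exists N : nat, forall n : nat, (N <= n)%N ->
        hnorm (g (x (phi n)) - y) < e.

(* the elementary operator T x = \sum_j a_j x b_j *)
Definition Tmap (l : nat) (a b : 'I_l -> H -> H) (x : H -> H) : H -> H :=
  fun xi => \sum_(j < l) a j (x (b j xi)).

(* T : B(H) -> B(H) is compact: the image of the unit ball of B(H) is
   relatively compact for the operator norm (sequential formulation) *)
Definition elem_op_compact (l : nat) (a b : 'I_l -> H -> H) : Prop :=
  forall x : nat -> (H -> H), (forall n, is_bop (x n) /\ opnorm_le (x n) 1) ->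
    exists (phi : nat -> nat) (y : H -> H),
      (forall n, (phi n < phi n.+1)%N) /\ is_bop y /\
      forall e : C, 0 < e -> exists N : nat, forall n : nat, (N <= n)%N ->
        opnorm_le (fun xi => Tmap a b (x (phi n)) xi - y xi) e.

(* Q(c, eta) = (<c_j eta, c_i eta>)_{i,j} *)
Definition Qmx (l : nat) (c : 'I_l -> H -> H) (eta : H) : 'M[C]_l :=
  \matrix_(i < l, j < l) hinner (c j eta) (c i eta).

(* linear independence of a family of operators *)
Definition lin_indep (l : nat) (c : 'I_l -> H -> H) : Prop :=
  forall k : 'I_l -> C, (forall xi : H, \sum_(j < l) k j *: c j xi = 0) ->
    forall j, k j = 0.

End Defs.

(* positive semidefinite complex matrices and their positive square root *)
Definition psd (R : realType) (l : nat) (X : 'M[R[i]]_l) : Prop :=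
  (forall i j, X j i = (X i j)^*) /\
  forall v : 'cV[R[i]]_l, 0 <= ((map_mx Num.conj v)^T *m X *m v) 0 0.

Definition msqrt (R : realType) (l : nat) (X : 'M[R[i]]_l) : 'M[R[i]]_l :=
  epsilon (inhabits 0) (fun S => psd S /\ S *m S = X).

Definition tgm (R : realType) (l : nat) (X Y : 'M[R[i]]_l) : R[i] :=
  \tr (msqrt (msqrt X *m Y *m msqrt X)).

Definition fT (R : realType) (H : hilbert R) (l : nat) (a b : 'I_l -> H -> H)
  (xi eta : H) : R[i] :=
  tgm (Qmx (fun j => adj (a j)) xi) (Qmx b eta).

(* f : H x H -> C, restricted to H_1 x H_1, is continuous at (xi0, eta0)
   for the product of the weak topologies (basic weak neighbourhoods). *)
Definition weak_cont_at (R : realType) (H : hilbert R) (f : H -> H -> R[i])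
  (xi0 eta0 : H) : Prop :=
  forall e : R[i], 0 < e ->
    exists (n : nat) (u v : 'I_n -> H) (d : R[i]), 0 < d /\
      forall xi eta : H, hnorm xi <= 1 -> hnorm eta <= 1 ->
        (forall k, `|hinner (xi - xi0) (u k)| < d) ->
        (forall k, `|hinner (eta - eta0) (v k)| < d) ->
        `|f xi eta - f xi0 eta0| < e.

(* Main.v *)
(* [fT a b xi eta] is the trace norm of [sum_j (b_j eta) (x) (a_j^* xi)^*], that
   is, the maximum of |<(T x) eta, xi>| over all contractions [x]; in particular
   it depends on T only, and [a], [b] may be replaced by linearly independent
   families.  For such families, each of (i) and (iii), tested on rank-one [x],
   shows that sum_j <a_j w, xi> b_j and sum_j <b_j eta, u> a_j are compact for
   all w, xi, eta, u; the coefficient vectors span C^l, so all a_j, b_j are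
   compact.  Conversely, compact operators are norm limits of finite rank
   operators, which makes the a_j^* and b_j weak-to-norm continuous on balls,
   hence [fT a b] weakly continuous, and {a_j x b_j : |x| <= 1} totally bounded. *)
Require Import Defs.
From mathcomp Require Import all_boot all_algebra.
From mathcomp Require Import reals.
From mathcomp.real_closed Require Import complex.
From mathcomp Require Import order sesquilinear spectral ring lra.
From mathcomp Require classical_sets.
From Stdlib Require Import ClassicalEpsilon.
Import Order.TTheory GRing.Theory Num.Theory.
Local Open Scope ring_scope.
Local Open Scope complex_scope.
Set Implicit Arguments.
Unset Strict Implicit.
Unset Printing Implicit Defensive.

(** * Inner products and bounded operators *)

Local Notation ip := hinner.
Local Notation cmod := ComplexField.Normc.normc.

(** Compactness of one operator is handled through [approximable], with error bound [e * nrm x],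
    which passes to linear combinations and adjoints. The necessity arguments only produce operators
    that do not separate the images of a bounded sequence, or that are small on a subspace of finite
    codimension; orthogonality arguments turn these forms into finite rank approximation. The
    reduction to independent families is forced: with a = (1, -1) and b = (1, 1) in infinite
    dimension, T vanishes although no coefficient is compact. Points with a zero coordinate suffice
    in (iii) because f_T vanishes there: continuity makes f_T(xi, z) small for all unit z orthogonal
    to finitely many vectors, and f_T dominates the pairing with every rank-one contraction. For the
    way back to (ii), two maxima over the same contractions differ by at most the largest difference
    of the competing values, which gives a Lipschitz estimate in the vectors a_j^* xi and b_j
    eta. *)

Lemma cmodE (R : realType) (z : R[i]) : `|z| = (cmod z)%:C.
Proof. by []. Qed.

Lemma cmod_ge0 (R : realType) (z : R[i]) : 0 <= cmod z.
Proof. by rewrite -ler0c -cmodE. Qed.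

Lemma cmod0 (R : realType) : cmod (0 : R[i]) = 0.
Proof. exact: ComplexField.Normc.normc0. Qed.

Lemma cmodM (R : realType) (x y : R[i]) : cmod (x * y) = cmod x * cmod y.
Proof. exact: ComplexField.Normc.normcM. Qed.

Lemma cmodJ (R : realType) (x : R[i]) : cmod (conjc x) = cmod x.
Proof. by apply: complexI; rewrite -!cmodE normcJ. Qed.

Lemma cmodD (R : realType) (x y : R[i]) : cmod (x + y) <= cmod x + cmod y.
Proof. by rewrite -lecR rmorphD /= -!cmodE ler_normD. Qed.

Lemma cmodN (R : realType) (x : R[i]) : cmod (- x) = cmod x.
Proof. by apply: complexI; rewrite -!cmodE normrN. Qed.

Lemma cmod_real (R : realType) (x : R) : 0 <= x -> cmod x%:C = x.
Proof. by move=> x0; apply: complexI; rewrite -cmodE ger0_norm ?ler0c. Qed.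

Lemma conjcM (R : realType) (x y : R[i]) : conjc (x * y) = conjc x * conjc y.
Proof. exact: rmorphM. Qed.

Lemma conjcD (R : realType) (x y : R[i]) : conjc (x + y) = conjc x + conjc y.
Proof. exact: rmorphD. Qed.

Lemma conjcN (R : realType) (x : R[i]) : conjc (- x) = - conjc x.
Proof. exact: rmorphN. Qed.

Lemma Re_le_cmod (R : realType) (z : R[i]) : complex.Re z <= cmod z.
Proof. by rewrite -lecR -cmodE; apply: le_trans (normc_ge_Re _); rewrite lecR ler_norm. Qed.

Lemma posC_real (R : realType) (e : R[i]) : 0 < e ->
  exists2 r : R, 0 < r & e = r%:C.
Proof.
rewrite ltcE /= => /andP[/eqP im0 re0]; exists (complex.Re e) => //.
by case: e im0 {re0} => a b /= ->.
Qed.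

Lemma sqr_le_mul_cancel (R : realDomainType) (a b : R) :
  0 <= a -> 0 <= b -> a ^+ 2 <= b * a -> a <= b.
Proof.
move=> a0 b0; have [->//|an0] := eqVneq a 0.
by rewrite expr2 ler_pM2r // lt_def an0.
Qed.

Section InnerProduct.
Variables (R : realType) (H : hilbert R).
Implicit Types (x y z : H) (a c : R[i]).

Definition nrm x : R := Num.sqrt (complex.Re (ip x x)).

Lemma ipDl x y z : ip (x + y) z = ip x z + ip y z.
Proof. by rewrite -{1}[x]scale1r hinnerDl mul1r. Qed.

Lemma ip0l z : ip (0 : H) z = 0.
Proof. by apply: (addrI (ip 0 z)); rewrite -ipDl !addr0. Qed.

Lemma ipZl a x z : ip (a *: x) z = a * ip x z.
Proof. by rewrite -[a *: x]addr0 hinnerDl ip0l addr0. Qed.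

Lemma ipDr x y z : ip z (x + y) = ip z x + ip z y.
Proof. by rewrite hinnerC ipDl conjcD -!hinnerC. Qed.

Lemma ipZr a x z : ip z (a *: x) = conjc a * ip z x.
Proof. by rewrite hinnerC ipZl conjcM -hinnerC. Qed.

Lemma ip0r z : ip z (0 : H) = 0.
Proof. by rewrite hinnerC ip0l conjc0. Qed.

Lemma ipNl x z : ip (- x) z = - ip x z.
Proof. by rewrite -scaleN1r ipZl mulN1r. Qed.

Lemma ipNr x z : ip z (- x) = - ip z x.
Proof. by rewrite hinnerC ipNl conjcN -hinnerC. Qed.

Lemma ipBl x y z : ip (x - y) z = ip x z - ip y z.
Proof. by rewrite ipDl ipNl. Qed.

Lemma ipBr x y z : ip z (x - y) = ip z x - ip z y.
Proof. by rewrite ipDr ipNr. Qed.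

Lemma ip_suml I (r : seq I) (P : pred I) (F : I -> H) z :
  ip (\sum_(i <- r | P i) F i) z = \sum_(i <- r | P i) ip (F i) z.
Proof. by exact: (big_morph (fun x => ip x z) (fun x y => ipDl x y z) (ip0l z)). Qed.

Lemma ip_sumr I (r : seq I) (P : pred I) (F : I -> H) z :
  ip z (\sum_(i <- r | P i) F i) = \sum_(i <- r | P i) ip z (F i).
Proof. by exact: (big_morph (ip z) (fun x y => ipDr x y z) (ip0r z)). Qed.

Lemma Re_ip_ge0 x : 0 <= complex.Re (ip x x).
Proof. by have := hinner_ge0 x; rewrite lecE => /andP[]. Qed.

Lemma nrm_ge0 x : 0 <= nrm x.
Proof. exact: sqrtr_ge0. Qed.

Lemma nrm2 x : nrm x ^+ 2 = complex.Re (ip x x).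
Proof. by rewrite sqr_sqrtr ?Re_ip_ge0. Qed.

Lemma ipxx x : ip x x = (nrm x ^+ 2)%:C.
Proof.
rewrite nrm2; have := ger0_Im (hinner_ge0 x).
by case: (ip x x) => u v /= ->.
Qed.

Lemma hnormE x : hnorm x = (nrm x)%:C.
Proof. by rewrite /hnorm ipxx rmorphXn /= sqrCK // ler0c nrm_ge0. Qed.

Lemma nrm0 : nrm 0 = 0.
Proof. by rewrite /nrm ip0l sqrtr0. Qed.

Lemma nrm_eq0 x : (nrm x == 0) = (x == 0).
Proof.
apply/eqP/eqP => [n0|->]; last exact: nrm0.
by apply: hinner_eq0; rewrite ipxx n0 expr0n.
Qed.

Lemma nrm_gt0 x : (0 < nrm x) = (x != 0).
Proof. by rewrite lt_def nrm_ge0 andbT nrm_eq0. Qed.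

Lemma nrmZ a x : nrm (a *: x) = cmod a * nrm x.
Proof.
apply/eqP; rewrite -(@eqrXn2 _ 2%N) ?mulr_ge0 ?cmod_ge0 ?nrm_ge0 //.
apply/eqP/complexI.
by rewrite -ipxx ipZl ipZr mulrA -sqr_normc ipxx cmodE -rmorphXn -rmorphM -exprMn.
Qed.

Lemma nrmN x : nrm (- x) = nrm x.
Proof. by rewrite /nrm ipNl ipNr opprK. Qed.

Lemma nrmB x y : nrm (x - y) = nrm (y - x).
Proof. by rewrite -nrmN opprB. Qed.

Lemma nrm2D x y :
  nrm (x + y) ^+ 2 = nrm x ^+ 2 + nrm y ^+ 2 + complex.Re (ip x y) *+ 2.
Proof.
rewrite !nrm2 ipDl !ipDr (hinnerC x y).
case: (ip x x) => ? ?; case: (ip y y) => ? ?; case: (ip x y) => ? ? /=; ring.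
Qed.

Lemma cauchy_schwarz x y : cmod (ip x y) <= nrm x * nrm y.
Proof.
have [->|y0] := eqVneq y 0; first by rewrite ip0r nrm0 mulr0 cmod0.
have ny : 0 < nrm y by rewrite nrm_gt0.
have nyC : (nrm y ^+ 2)%:C != 0 by rewrite -ipxx; apply/eqP => /hinner_eq0 /eqP; apply/negP.
(* [c *: y] is the projection of [x] on the line of [y]; the squared norm of the residual gives the
   inequality. *)
pose c := ip x y / (nrm y ^+ 2)%:C.
have : 0 <= nrm (x - c *: y) ^+ 2 by rewrite sqr_ge0.
have -> : nrm (x - c *: y) ^+ 2 = nrm x ^+ 2 - cmod (ip x y) ^+ 2 / nrm y ^+ 2.
  have ec : conjc c = conjc (ip x y) / (nrm y ^+ 2)%:C.
    by rewrite /c conjcM conjc_inv conjc_real.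
  have e2 : (nrm x ^+ 2 - cmod (ip x y) ^+ 2 / nrm y ^+ 2)%:C =
      (nrm x ^+ 2)%:C - ip x y * conjc (ip x y) / (nrm y ^+ 2)%:C.
    by rewrite rmorphB fmorph_div /= -sqr_normc cmodE -rmorphXn.
  apply: complexI; rewrite -ipxx e2 ipBl !ipBr !ipZl !ipZr ec !ipxx (hinnerC x y) /c.
  by field; apply: contra nyC => /eqP; rewrite rmorphXn /= => ->; rewrite expr0n.
rewrite subr_ge0 ler_pdivrMr ?exprn_gt0 // -exprMn.
by rewrite ler_pXn2r // nnegrE ?mulr_ge0 ?cmod_ge0 ?nrm_ge0.
Qed.

Lemma nrmD x y : nrm (x + y) <= nrm x + nrm y.
Proof.
rewrite -(@ler_pXn2r _ 2) ?nnegrE ?addr_ge0 ?nrm_ge0 // nrm2D sqrrD.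
have := le_trans (Re_le_cmod (ip x y)) (cauchy_schwarz x y); lra.
Qed.

Lemma nrm_triangle x y z : nrm (x - z) <= nrm (x - y) + nrm (y - z).
Proof. by rewrite -(subrKA y) nrmD. Qed.

Lemma nrm_sum I (r : seq I) (P : pred I) (F : I -> H) :
  nrm (\sum_(i <- r | P i) F i) <= \sum_(i <- r | P i) nrm (F i).
Proof.
elim/big_rec2: _ => [|i u v _ h]; first by rewrite nrm0.
by apply: le_trans (nrmD _ _) _; rewrite lerD2l.
Qed.

Lemma ip_ext x y : (forall z, ip z x = ip z y) -> x = y.
Proof.
move=> e; apply/eqP; rewrite -subr_eq0 -nrm_eq0 -sqrf_eq0 nrm2 ipBr e subrr.
by [].
Qed.

Lemma nrm_normalize x : x != 0 -> nrm ((nrm x)^-1%:C *: x) = 1.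
Proof.
by move=> x0; rewrite nrmZ cmod_real ?invr_ge0 ?nrm_ge0 // mulVf // nrm_eq0.
Qed.

Lemma nrm_le_dual x (r : R) : 0 <= r ->
  (forall u, nrm u <= 1 -> cmod (ip x u) <= r) -> nrm x <= r.
Proof.
move=> c0 h; have [->|x0] := eqVneq x 0; first by rewrite nrm0.
have := h _ _; have n1 := nrm_normalize x0.
move=> /(_ ((nrm x)^-1%:C *: x)); rewrite n1 lexx => /(_ isT).
rewrite ipZr conjc_real ipxx cmodM !cmod_real ?invr_ge0 ?exprn_ge0 ?nrm_ge0 //.
by rewrite expr2 mulKf ?nrm_eq0.
Qed.

End InnerProduct.

Section BoundedOperators.
Variables (R : realType) (H : hilbert R).
Implicit Types (x y z : H) (a c : R[i]) (g h : H -> H) (M : R).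

Lemma opnorm_leE g (e : R) :
  opnorm_le g e%:C <-> forall x, nrm (g x) <= e * nrm x.
Proof.
by split=> h x; have := h x; rewrite !hnormE -rmorphM /= lecR.
Qed.

Lemma is_bop_lin g : is_bop g -> forall a x y, g (a *: x + y) = a *: g x + g y.
Proof. by case. Qed.

(** The bound in [is_bop] is a complex number. Its product with [hnorm x] dominates a norm, hence
    equals its own modulus, and [cmod M] serves as a real bound. *)
Lemma is_bop_bound g : is_bop g ->
  exists2 M, 0 <= M & forall x, nrm (g x) <= M * nrm x.
Proof.
case=> _ [M hM]; exists (cmod M); first exact: cmod_ge0.
move=> x; have := hM x; rewrite !hnormE => h.
rewrite -lecR rmorphM /= -cmodE -[(nrm x)%:C]ger0_norm ?ler0c ?nrm_ge0 //.
by rewrite -normrM ger0_norm // (le_trans _ h) // ler0c nrm_ge0.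
Qed.

Lemma is_bop_bound_fam l (g : 'I_l -> H -> H) : (forall j, is_bop (g j)) ->
  exists2 M, 0 < M & forall j x, nrm (g j x) <= M * nrm x.
Proof.
elim: l g => [|l IH] g hg; first by exists 1 => // -[].
have [M M0 hM] := IH (fun j => g (lift ord0 j)) (fun j => hg _).
have [N N0 hN] := is_bop_bound (hg ord0).
exists (M + N); first by rewrite ltr_wpDr.
move=> j x; have := nrm_ge0 x; case: (unliftP ord0 j) => [i|] -> x0.
  by apply: le_trans (hM i x) _; rewrite ler_wpM2r // lerDl.
by apply: le_trans (hN x) _; rewrite ler_wpM2r // lerDr ltW.
Qed.

Lemma is_bopI g M : (forall a x y, g (a *: x + y) = a *: g x + g y) ->
  (forall x, nrm (g x) <= M * nrm x) -> is_bop g.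
Proof. by move=> hl hb; split=> //; exists M%:C; apply/opnorm_leE. Qed.

Lemma bopD g x y : is_bop g -> g (x + y) = g x + g y.
Proof. by move=> /is_bop_lin hg; rewrite -[x]scale1r hg !scale1r. Qed.

Lemma bop0 g : is_bop g -> g 0 = 0.
Proof. by move=> hg; apply: (addrI (g 0)); rewrite -bopD // !addr0. Qed.

Lemma bopZ g a x : is_bop g -> g (a *: x) = a *: g x.
Proof.
by move=> hg; rewrite -[a *: x]addr0 (is_bop_lin hg) (bop0 hg) addr0.
Qed.

Lemma bopB g x y : is_bop g -> g (x - y) = g x - g y.
Proof. by move=> hg; rewrite bopD // -scaleN1r bopZ // scaleN1r. Qed.

Lemma bop_sum g I (r : seq I) (P : pred I) (F : I -> H) : is_bop g ->
  g (\sum_(i <- r | P i) F i) = \sum_(i <- r | P i) g (F i).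
Proof.
by move=> hg; apply: (big_morph g) => [x y|]; rewrite ?bopD ?bop0.
Qed.

Lemma is_bop_axpy a g h : is_bop g -> is_bop h ->
  is_bop (fun x => a *: g x + h x).
Proof.
move=> hg hh; have [M _ hM] := is_bop_bound hg; have [N _ hN] := is_bop_bound hh.
apply: (@is_bopI _ (cmod a * M + N)) => [c x y|x].
  rewrite !(is_bop_lin hg) !(is_bop_lin hh) !scalerDr !scalerA mulrC -!addrA.
  by congr (_ + _); rewrite addrCA.
apply: le_trans (nrmD _ _) _; rewrite mulrDl lerD // nrmZ -mulrA.
by rewrite ler_wpM2l ?cmod_ge0.
Qed.

Lemma is_bop_comb l (v : 'I_l -> R[i]) (g : 'I_l -> H -> H) :
  (forall j, is_bop (g j)) -> is_bop (fun x => \sum_j v j *: g j x).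
Proof.
move=> hg; have [M _ hM] := is_bop_bound_fam hg.
apply: (@is_bopI _ (\sum_j cmod (v j) * M)) => [c x y|x].
  rewrite scaler_sumr -big_split; apply: eq_bigr => j _ /=.
  by rewrite (is_bop_lin (hg j)) scalerDr !scalerA mulrC.
rewrite mulr_suml; apply: le_trans (nrm_sum _ _ _) _; apply: ler_sum => j _.
by rewrite nrmZ -mulrA ler_wpM2l ?cmod_ge0.
Qed.

Definition rank1 (u w : H) : H -> H := fun x => ip x u *: w.

Lemma nrm_rank1 (u w x : H) : nrm (rank1 u w x) <= nrm u * nrm w * nrm x.
Proof.
rewrite /rank1 nrmZ mulrAC ler_wpM2r ?nrm_ge0 // mulrC; exact: cauchy_schwarz.
Qed.

Lemma is_bop_rank1 (u w : H) : is_bop (rank1 u w).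
Proof.
apply: (is_bopI _ (@nrm_rank1 u w)) => a x y.
by rewrite /rank1 hinnerDl scalerDl scalerA.
Qed.

Definition contraction g := is_bop g /\ opnorm_le g 1.

Lemma contraction_le g : contraction g -> forall y, nrm (g y) <= nrm y.
Proof. by case=> _ /(opnorm_leE g 1) h y; have := h y; rewrite mul1r. Qed.

Lemma contractionI g : (forall a y z, g (a *: y + z) = a *: g y + g z) ->
  (forall y, nrm (g y) <= nrm y) -> contraction g.
Proof.
move=> hl hb; split; first by apply: (is_bopI (M := 1) hl) => y; rewrite mul1r.
by apply/(opnorm_leE g 1) => y; rewrite mul1r.
Qed.

Lemma contraction_rank1 (u w : H) : nrm u <= 1 -> nrm w <= 1 ->
  contraction (rank1 u w).
Proof.
move=> hu hw; apply: contractionI => [|y]; first by case: (is_bop_rank1 u w).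
apply: le_trans (nrm_rank1 u w y) _.
by rewrite ler_piMl ?nrm_ge0 // mulr_ile1 ?nrm_ge0.
Qed.

Lemma hilbert_complete (u : nat -> H) :
  (forall e : R, 0 < e -> exists N, forall m n, (N <= m)%N -> (N <= n)%N ->
     nrm (u m - u n) < e) ->
  exists x, forall e : R, 0 < e -> exists N, forall n, (N <= n)%N ->
     nrm (u n - x) < e.
Proof.
move=> hu; have [|x hx] := @hcomplete _ H u.
  move=> _ /posC_real[e /hu [N hN] ->]; exists N => m n mN nN.
  by rewrite -/(hnorm _) hnormE ltcR hN.
exists x => e e0; have [|N hN] := hx e%:C; first by rewrite ltcR.
by exists N => n /hN; rewrite -/(hnorm _) hnormE ltcR.
Qed.

End BoundedOperators.

(** At t = -A / (B + 1) the quadratic equals -A^2 (B + 2) / (B + 1)^2; the shift by 1 covers B = 0.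
    This is the first-order condition at a minimum. *)
Lemma quadratic_ge0_linear0 (R : realFieldType) (A B : R) : 0 <= B ->
  (forall t, 0 <= 2 * t * A + t ^+ 2 * B) -> A = 0.
Proof.
move=> B0 /(_ (- A / (B + 1))).
have B1 : 0 < B + 1 by rewrite ltr_wpDl.
have -> : 2 * (- A / (B + 1)) * A + (- A / (B + 1)) ^+ 2 * B =
   - (A ^+ 2 * (B + 2) / (B + 1) ^+ 2) by field; lra.
rewrite oppr_ge0 pmulr_lle0 ?invr_gt0 ?exprn_gt0 // pmulr_lle0 ?ltr_wpDl //.
by rewrite le_eqVlt ltNge sqr_ge0 orbF sqrf_eq0 => /eqP.
Qed.

Lemma inf_attaining_seq (R : realType) (T : Type) (J : T -> R) (t0 : T) (b : R) :
  (forall t, b <= J t) ->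
  exists (m : R) (x : nat -> T), (forall t, m <= J t) /\
    forall n, J (x n) < m + n.+1%:R^-1.
Proof.
move=> hb; pose E := (fun r => exists t, J t = r) : classical_sets.set R.
have hE : classical_sets.has_inf E.
  by split; [exists (J t0), t0 | exists b => _ [t <-]].
exists (inf E).
have hx n : exists t, J t < inf E + n.+1%:R^-1.
  have [|_ [t <-] ht] := @inf_adherent _ E n.+1%:R^-1 _ hE; last by exists t.
  by rewrite invr_gt0 ltr0n.
exists (fun n => epsilon (inhabits t0) (fun t => J t < inf E + n.+1%:R^-1)).
split=> [t|n]; last exact: epsilon_spec (hx n).
by apply: ge_inf; [case: hE | exists t].
Qed.

Lemma inv_succ_gt0 (R : realType) k : 0 < k.+1%:R^-1 :> R.
Proof. by rewrite invr_gt0 ltr0n. Qed.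

Lemma inv_succ_lt (R : realType) (e : R) : 0 < e ->
  exists N, forall n, (N <= n)%N -> n.+1%:R^-1 < e.
Proof.
move=> e0; exists (Num.truncn e^-1) => n hn.
rewrite invf_plt ?posrE ?ltr0n //.
apply: lt_le_trans (truncnS_gt _) _; by rewrite ler_nat ltnS.
Qed.

(** * Riesz representation and adjoints *)

Section Riesz.
Variables (R : realType) (H : hilbert R).
Implicit Types (x y z : H) (a c : R[i]) (g h : H -> H).

(* [z] is obtained by minimising [|x|^2 - 2 Re (phi x)]; the parallelogram law
   makes every minimising sequence Cauchy. *)
Lemma riesz (phi : H -> R[i]) (M : R) :
  (forall a x y, phi (a *: x + y) = a * phi x + phi y) ->
  (forall x, cmod (phi x) <= M * nrm x) ->
  exists z, forall x, phi x = ip x z.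
Proof.
move=> phiL phiB.
have phi0 : phi 0 = 0.
  by apply: (addrI (1 * phi 0)); rewrite -phiL scaler0 addr0 mul1r addr0.
have phiD x y : phi (x + y) = phi x + phi y.
  by rewrite -{1}[x]scale1r phiL mul1r.
have phiZ a x : phi (a *: x) = a * phi x by rewrite -[a *: x]addr0 phiL phi0 addr0.
pose J x : R := nrm x ^+ 2 - 2 * complex.Re (phi x).
have JB x : - M ^+ 2 <= J x.
  have h1 := le_trans (Re_le_cmod _) (phiB x).
  have h2 := sqr_ge0 (nrm x - M); rewrite /J; nra.
have [m [u [hm hu]]] := inf_attaining_seq (0 : H) JB.
have ReZ (t : R) (w : R[i]) : complex.Re (t%:C * w) = t * complex.Re w.
  by case: w => ? ? /=; rewrite mul0r subr0.
have JD x y (t : R) : J (x + t%:C *: y) = J x +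
    (2 * t * (complex.Re (ip x y) - complex.Re (phi y)) + t ^+ 2 * nrm y ^+ 2).
  rewrite /J nrm2D nrmZ phiD phiZ ipZr conjc_real raddfD /= !ReZ.
  have -> : (cmod t%:C * nrm y) ^+ 2 = t ^+ 2 * nrm y ^+ 2.
    by rewrite exprMn /= expr0n addr0 sqr_sqrtr ?sqr_ge0.
  ring.
(* Since [J] is at least [m] at the midpoint of [x] and [y], expanding [J] along the segment bounds
   its length. *)
have par x y : nrm (x - y) ^+ 2 <= 2 * (J x - m) + 2 * (J y - m).
  have := hm (x + (2^-1)%:C *: (y - x)).
  have : J y = J (x + 1%:C *: (y - x)) by rewrite scale1r addrC subrK.
  rewrite !JD (nrmB x y); lra.
have [|z hz] := @hilbert_complete _ H u.
  move=> e e0; have [|N hN] := @inv_succ_lt R (e ^+ 2 / 4).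
    by rewrite divr_gt0 ?exprn_gt0.
  exists N => i j /hN hi /hN hj.
  rewrite -(@ltr_pXn2r _ 2) ?nnegrE ?nrm_ge0 ?(ltW e0) //.
  have {hi}h1 : J (u i) - m < e ^+ 2 / 4 by rewrite ltrBlDl (lt_trans (hu i)) ?ltrD2l.
  have {hj}h2 : J (u j) - m < e ^+ 2 / 4 by rewrite ltrBlDl (lt_trans (hu j)) ?ltrD2l.
  apply: le_lt_trans (par _ _) _; lra.
(* Real parts suffice: evaluation at ['i *: x] recovers the imaginary parts. *)
exists z; suff hRe x : complex.Re (phi x) = complex.Re (ip x z).
  move=> x; have := hRe x; have := hRe ('i%C *: x).
  rewrite phiZ ipZl; case: (phi x) (ip x z) => ? ? [? ?] /=.
  by rewrite !mul0r !mul1r !add0r => /oppr_inj -> ->.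
apply/esym/eqP; rewrite -subr_eq0; apply/eqP.
apply: (@quadratic_ge0_linear0 _ _ (nrm x ^+ 2)); first exact: sqr_ge0.
have -> : complex.Re (ip x z) = complex.Re (ip z x).
  by rewrite (hinnerC x z); case: (ip x z).
(* The inequality is read at [u n] in place of [z]. Half of the error [e] pays for J(u n) - m, the
   other half for replacing [u n] by [z] in the linear term, which is what [K] measures. *)
move=> t; apply/ler_addgt0Pr => e e0.
pose K := 4 * `|t| * (nrm x + 1).
have K0 : 0 <= K by rewrite !mulr_ge0 ?addr_ge0 ?nrm_ge0.
have e2 : 0 < e / 2 by rewrite divr_gt0.
have [N1 hN1] := inv_succ_lt e2.
have [|N2 hN2] := hz (e / (K + 1)); first by rewrite divr_gt0 ?ltr_wpDl.
pose n := maxn N1 N2; have := hN1 n (leq_maxl _ _); have := hN2 n (leq_maxr _ _).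
rewrite ltr_pdivlMr ?ltr_wpDl // => h2 h1.
have := hm (u n + t%:C *: x); rewrite JD; have := hu n.
set A := 2 * t * (_ - _) + _; move=> h3 h4.
have h3' : J (u n) - m < e / 2 by rewrite ltrBlDl (lt_trans h3) ?ltrD2l.
have hA : - (e / 2) < A by lra.
have h5 : 2 * t * (complex.Re (ip (u n) x) - complex.Re (ip z x)) <= e / 2.
  rewrite -raddfB -ipBl; apply: le_trans (ler_norm _) _; rewrite !normrM ger0_norm //.
  have h6 : `|complex.Re (ip (u n - z) x)| <= nrm (u n - z) * nrm x.
    by rewrite -lecR; apply: le_trans (normc_ge_Re _) _; rewrite lecR cauchy_schwarz.
  have h7 : 2 * `|t| * `|complex.Re (ip (u n - z) x)| <= 2 * `|t| * (nrm (u n - z) * nrm x).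
    by rewrite ler_wpM2l // mulr_ge0.
  apply: le_trans h7 _; have n0 := nrm_ge0 (u n - z); have t0 := normr_ge0 t.
  have := mulr_ge0 n0 t0; rewrite /K in h2; nra.
by move: hA h5; rewrite /A; lra.
Qed.

(** Riesz represents x |-> <g x, y> for each y; choosing a representing vector for every y yields a
    function of the kind that [adj] selects. *)
Lemma adjP g : is_bop g -> forall x y, ip (g x) y = ip x (adj g y).
Proof.
move=> hg; apply: (epsilon_spec (inhabits g)
  (fun g' => forall x y, hinner (g x) y = hinner x (g' y))).
have [M M0 hM] := is_bop_bound hg.
have hz y : exists z, forall x, ip (g x) y = ip x z.
  apply: (@riesz (fun x => ip (g x) y) (M * nrm y)) => [a x x'|x].
    by rewrite (is_bop_lin hg) hinnerDl.
  apply: le_trans (cauchy_schwarz _ _) _.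
  by rewrite mulrAC ler_wpM2r ?nrm_ge0.
exists (fun y => epsilon (inhabits y) (fun z => forall x, ip (g x) y = ip x z)).
by move=> x y; have := epsilon_spec (inhabits y) _ (hz y); apply.
Qed.

Lemma adjPr g : is_bop g -> forall x y, ip (adj g x) y = ip x (g y).
Proof. by move=> hg x y; rewrite hinnerC -adjP // -hinnerC. Qed.

(** |g^* x|^2 = <g g^* x, x> <= M |g^* x| |x|, and one factor cancels. *)
Lemma nrm_adj g M : is_bop g -> 0 <= M ->
  (forall x, nrm (g x) <= M * nrm x) -> forall x, nrm (adj g x) <= M * nrm x.
Proof.
move=> hg M0 hM x; apply: sqr_le_mul_cancel; rewrite ?mulr_ge0 ?nrm_ge0 //.
rewrite nrm2 -adjP //; apply: le_trans (Re_le_cmod _) _.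
apply: le_trans (cauchy_schwarz _ _) _.
by rewrite mulrAC ler_wpM2r ?nrm_ge0.
Qed.

Lemma is_bop_adj g : is_bop g -> is_bop (adj g).
Proof.
move=> hg; have [M M0 hM] := is_bop_bound hg.
apply: (is_bopI _ (nrm_adj hg M0 hM)) => a x y.
by apply: ip_ext => z; rewrite -adjP // !ipDr !ipZr !adjP.
Qed.

End Riesz.

(** * The trace norm of a finite sum of rank-one operators *)

Section PositiveMatrices.
Variable R : realType.
Local Notation C := R[i].
Local Open Scope sesquilinear_scope.

Lemma mxtrC_mul m n p (A : 'M[C]_(m, n)) (B : 'M[C]_(n, p)) :
  (A *m B)^t* = B^t* *m A^t*.
Proof. by rewrite trmx_mul map_mxM. Qed.

Lemma psd_herm l (X : 'M[C]_l) : psd X -> X^t* = X.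
Proof. by case=> hX _; apply/matrixP => i j; rewrite !mxE hX; exact: conjcK. Qed.

Lemma psd_form l (X : 'M[C]_l) (v : 'cV_l) : psd X -> 0 <= (v^t* *m X *m v) 0 0.
Proof. by case=> _ /(_ v); rewrite -map_trmx. Qed.

Lemma psdI l (X : 'M[C]_l) : X^t* = X ->
  (forall v : 'cV_l, 0 <= (v^t* *m X *m v) 0 0) -> psd X.
Proof.
move=> hX hv; split=> [i j|v]; last by have := hv v; rewrite -map_trmx.
by rewrite -{1}hX !mxE.
Qed.

Lemma normsq_col n (v : 'cV[C]_n) : (v^t* *m v) 0 0 = \sum_k `|v k 0| ^+ 2.
Proof. by rewrite mxE; apply: eq_bigr => k _; rewrite !mxE mulrC normCK. Qed.

Lemma psd_congr l m (X : 'M[C]_l) (A : 'M[C]_(l, m)) : psd X ->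
  psd (A^t* *m X *m A).
Proof.
move=> hX; apply: psdI => [|v].
  by rewrite !mxtrC_mul trmxCK (psd_herm hX) mulmxA.
have -> : v^t* *m (A^t* *m X *m A) *m v = (A *m v)^t* *m X *m (A *m v).
  by rewrite mxtrC_mul !mulmxA.
exact: psd_form.
Qed.

Lemma psd_diag l (d : 'rV[C]_l) : (forall k, 0 <= d 0 k) -> psd (diag_mx d).
Proof.
move=> hd; apply: psdI => [|v].
  apply/matrixP => i j; rewrite !mxE eq_sym.
  have [->|ij] := eqVneq i j; first by rewrite !mulr1n geC0_conj.
  by rewrite !mulr0n rmorph0.
rewrite mul_mx_diag mxE; apply: sumr_ge0 => k _; rewrite !mxE.
by rewrite mulrAC mulrC mulr_ge0 // mulrC -normCK exprn_ge0.
Qed.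

Lemma psd_spectral l (X : 'M[C]_l) : psd X ->
  exists (V : 'M[C]_l) (d : 'rV[C]_l), [/\ V^t* *m V = 1%:M, V *m V^t* = 1%:M,
    (forall k, 0 <= d 0 k) & X = V *m diag_mx d *m V^t*].
Proof.
move=> hX; have /orthomx_spectralP : X \is normalmx.
  by apply/normalmxP; rewrite psd_herm.
set P := spectralmx X; set d := spectral_diag X => eX.
have hP : P \is unitarymx := spectral_unitarymx X.
have hP1 : P *m P^t* = 1%:M by apply/unitarymxP.
have hP2 : P^t* *m P = 1%:M by apply: mulmx1C.
rewrite invmx_unitary // in eX.
exists (P^t*), d; rewrite trmxCK; split=> // k.
(* The column [P^t* *m delta_mx k 0] is the k-th eigenvector, where the form of [X] takes the value
   [d 0 k]. *)
have := psd_form (P^t* *m delta_mx k 0) hX.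
rewrite mxtrC_mul trmxCK eX !mulmxA -!(mulmxA _ P (P^t*)) hP1 !mulmx1.
rewrite -mulmxA mul_diag_mx mxE (bigD1 k) //= big1.
  by rewrite addr0 !mxE !eqxx mulr1 rmorph1 mul1r.
by move=> j jk; rewrite !mxE (negPf jk) rmorph0 mul0r.
Qed.

Lemma msqrtP l (X : 'M[C]_l) : psd X ->
  psd (msqrt X) /\ msqrt X *m msqrt X = X.
Proof.
move=> hX; apply: (epsilon_spec (inhabits 0) (fun S => psd S /\ S *m S = X)).
have [V [d [V1 V2 hd ->]]] := psd_spectral hX.
exists (V *m diag_mx (\row_k sqrtC (d 0 k)) *m V^t*); split.
  rewrite -{1}[V]trmxCK; apply: psd_congr; apply: psd_diag => k.
  by rewrite mxE sqrtC_ge0.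
rewrite !mulmxA -(mulmxA _ (V^t*) V) V1 mulmx1 -(mulmxA V (diag_mx _)) mulmx_diag.
by congr (_ *m diag_mx _ *m _); apply/rowP => k; rewrite !mxE -expr2 sqrtCK.
Qed.

(** The Moore-Penrose inverse, obtained by inverting the eigenvalues; the convention 0^-1 = 0 gives
    the right value on the kernel. *)
Lemma psd_pinv l (S : 'M[C]_l) : psd S ->
  exists T : 'M[C]_l, [/\ T^t* = T, T *m S = S *m T & S *m T *m S = S].
Proof.
move=> hS; have [V [d [V1 V2 hd ->]]] := psd_spectral hS.
have mulV (u w : 'rV[C]_l) : (V *m diag_mx u *m V^t*) *m (V *m diag_mx w *m V^t*) =
    V *m diag_mx (\row_k (u 0 k * w 0 k)) *m V^t*.
  by rewrite -mulmx_diag !mulmxA -(mulmxA _ (V^t*) V) V1 mulmx1.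
exists (V *m diag_mx (\row_k (d 0 k)^-1) *m V^t*); split.
- apply: psd_herm; rewrite -{1}[V]trmxCK; apply: psd_congr; apply: psd_diag => k.
  by rewrite mxE invr_ge0.
- rewrite !mulV; congr (_ *m diag_mx _ *m _); apply/rowP => k.
  by rewrite !mxE mulrC.
rewrite !mulV; congr (_ *m diag_mx _ *m _); apply/rowP => k; rewrite !mxE.
by have [->|dk] := eqVneq (d 0 k) 0; rewrite ?mul0r // mulfV // mul1r.
Qed.

End PositiveMatrices.

(** * Gram matrices, contractive families and the trace norm *)

Section Families.
Variables (R : realType) (H : hilbert R).
Local Notation C := R[i].
Local Open Scope sesquilinear_scope.

(** Let P : C^l -> H have the columns [p j]. Then [gram p] is the matrix of P^* P, and [fam p A]
    lists the columns of P A. The matrices [Qmx c eta] are Gram matrices of the vectors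
    [c j eta]. *)
Definition gram l (p : 'I_l -> H) : 'M[C]_l := \matrix_(i, j) ip (p j) (p i).

Definition fam l m (p : 'I_l -> H) (A : 'M[C]_(l, m)) : 'I_m -> H :=
  fun k => \sum_j A j k *: p j.

Lemma gram_fam l m (p : 'I_l -> H) (A : 'M[C]_(l, m)) :
  gram (fam p A) = A^t* *m gram p *m A.
Proof.
apply/matrixP => i j; rewrite !mxE ip_suml; apply: eq_bigr => k _.
rewrite ipZl ip_sumr mxE mulrC mulr_suml mulr_suml; apply: eq_bigr => n _.
by rewrite !mxE ipZr.
Qed.

Lemma fam_mul l m n (p : 'I_l -> H) (A : 'M[C]_(l, m)) (B : 'M[C]_(m, n)) :
  fam p (A *m B) =1 fam (fam p A) B.
Proof.
move=> k; rewrite /fam.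
under eq_bigr do rewrite mxE scaler_suml.
rewrite exchange_big; apply: eq_bigr => i _; rewrite scaler_sumr.
by apply: eq_bigr => j _; rewrite scalerA mulrC.
Qed.

Lemma fam1 l (p : 'I_l -> H) : fam p 1%:M =1 p.
Proof.
move=> k; rewrite /fam (bigD1 k) //= big1 ?addr0 ?mxE ?eqxx ?scale1r //.
by move=> j jk; rewrite mxE (negPf jk) scale0r.
Qed.

(** The k-th diagonal entry of the vanishing matrix is the squared norm of the difference of the
    k-th vectors. *)
Lemma fam_eq l m (p : 'I_l -> H) (A B : 'M[C]_(l, m)) :
  (A - B)^t* *m gram p *m (A - B) = 0 -> fam p A =1 fam p B.
Proof.
rewrite -gram_fam => /matrixP h k; have := h k k; rewrite !mxE => /hinner_eq0.
move=> h0; apply/eqP; rewrite -subr_eq0 -h0 /fam -sumrB; apply/eqP.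
by apply: eq_bigr => j _; rewrite !mxE scalerBl.
Qed.

Lemma psd_gram l (p : 'I_l -> H) : psd (gram p).
Proof.
apply: psdI => [|v]; first by apply/matrixP => i j; rewrite !mxE; exact/esym/hinnerC.
by rewrite -gram_fam mxE hinner_ge0.
Qed.

Lemma sum_ip_fam l m (x : H -> H) (p : 'I_l -> H) (r : 'I_m -> H)
    (A : 'M[C]_(l, m)) : is_bop x ->
  \sum_k ip (x (fam p A k)) (r k) = \sum_j ip (x (p j)) (fam r (A^t*) j).
Proof.
move=> hx; under eq_bigr do rewrite bop_sum // ip_suml.
rewrite exchange_big; apply: eq_bigr => j _; rewrite ip_sumr.
by apply: eq_bigr => k _; rewrite bopZ // ipZl !mxE ipZr conjcK.
Qed.

(** The map C^l -> H that sends the k-th basis vector to [r k] has norm at most 1. *)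
Definition contractive_fam l (r : 'I_l -> H) :=
  forall c : 'I_l -> C, nrm (\sum_k c k *: r k) ^+ 2 <= \sum_k cmod (c k) ^+ 2.

Lemma contractive_fam_nrm l (r : 'I_l -> H) k : contractive_fam r -> nrm (r k) <= 1.
Proof.
move=> /(_ (fun j => (j == k)%:R)); rewrite (bigD1 k) //= eqxx scale1r.
rewrite big1 => [|j jk]; last by rewrite (negPf jk) scale0r.
rewrite (bigD1 k) //= eqxx big1 => [|j jk]; last by rewrite (negPf jk) cmod0 expr0n.
rewrite !addr0 ComplexField.Normc.normc1 expr1n.
by rewrite expr_le1 // nrm_ge0.
Qed.

(** The defect |v|^2 - v^* G v, with G the Gram matrix, equals |(1 - G) v|^2 because 1 - G is a
    self-adjoint idempotent. *)
Lemma contractive_fam_proj l (r : 'I_l -> H) :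
  gram r *m gram r = gram r -> contractive_fam r.
Proof.
move=> h c; pose v : 'cV[C]_l := \col_k c k.
have hG := psd_herm (psd_gram r).
have e1 : (nrm (\sum_k c k *: r k) ^+ 2)%:C = (v^t* *m gram r *m v) 0 0.
  by rewrite -gram_fam mxE -ipxx; congr (ip _ _); apply: eq_bigr => k _; rewrite mxE.
have e2 : (\sum_k cmod (c k) ^+ 2)%:C = (v^t* *m v) 0 0.
  rewrite normsq_col rmorph_sum; apply: eq_bigr => k _.
  by rewrite mxE cmodE -rmorphXn.
rewrite -lecR e1 e2 -subr_ge0.
have -> : (v^t* *m v) 0 0 - (v^t* *m gram r *m v) 0 0 =
    (((1%:M - gram r) *m v)^t* *m ((1%:M - gram r) *m v)) 0 0.
  have -> : ((1%:M - gram r) *m v)^t* = v^t* *m (1%:M - gram r).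
    by rewrite mxtrC_mul linearB /= map_mxB hG trmx1 map_mx1.
  rewrite mulmxA -(mulmxA (v^t*) (1%:M - _)).
  rewrite (_ : (_ - _) *m (_ - _) = 1%:M - gram r).
    rewrite mulmxBr mulmxBl mulmx1; move: (_ *m v) (_ *m v) => A B; by rewrite !mxE.
  by rewrite mulmxBl !mulmxBr !mul1mx mulmx1 h subrr subr0.
by rewrite normsq_col sumr_ge0 // => k _; rewrite exprn_ge0.
Qed.

(* Bessel's inequality, by duality with [contractive_fam]. *)
Lemma contractive_fam_bessel l (g : 'I_l -> H) (z : H) : contractive_fam g ->
  \sum_k cmod (ip z (g k)) ^+ 2 <= nrm z ^+ 2.
Proof.
move=> hg; set B := \sum_k _.
have := hg (fun k => ip z (g k)); rewrite -/B; set y := \sum_k _ => hy.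
have eB : ip z y = B%:C.
  rewrite ip_sumr rmorph_sum; apply: eq_bigr => k _.
  by rewrite ipZr mulrC -sqr_normc cmodE -rmorphXn.
have B0 : 0 <= B by rewrite sumr_ge0 // => k _; rewrite exprn_ge0 ?cmod_ge0.
have := cauchy_schwarz z y; rewrite eB cmod_real // => hB.
have hB2 : B ^+ 2 <= nrm z ^+ 2 * B.
  apply: (@le_trans _ _ (nrm z ^+ 2 * nrm y ^+ 2)); last by rewrite ler_wpM2l ?sqr_ge0.
  by rewrite -exprMn ler_pXn2r // nnegrE ?mulr_ge0 ?nrm_ge0.
by apply: sqr_le_mul_cancel hB2; rewrite ?sqr_ge0.
Qed.

Lemma contraction_of_fams l (g r : 'I_l -> H) :
  contractive_fam g -> contractive_fam r ->
  contraction (fun z => \sum_k ip z (g k) *: r k).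
Proof.
move=> hg hr; apply: contractionI => [a y z|z].
  rewrite scaler_sumr -big_split; apply: eq_bigr => k _ /=.
  by rewrite hinnerDl scalerDl scalerA.
rewrite -(@ler_pXn2r _ 2) ?nnegrE ?nrm_ge0 //.
by apply: le_trans (hr _) _; exact: contractive_fam_bessel.
Qed.

(* Polar decomposition [q = r |q|] of the operator C^l -> H whose columns are
   the [q j], with [S = |q|] and [r] a partial isometry. *)
Lemma polar_fam l (q : 'I_l -> H) (S : 'M[C]_l) : psd S -> S *m S = gram q ->
  exists r : 'I_l -> H, [/\ q =1 fam r S, gram r *m gram r = gram r &
    gram r *m S = S].
Proof.
move=> hS eS; have [T [hT TS STS]] := psd_pinv hS.
have gF : gram (fam q T) = T *m S.
  by rewrite gram_fam hT -eS mulmxA -mulmxA -TS -mulmxA (mulmxA S) STS.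
(* The partial isometry is q |q|^+; its Gram matrix T S is the projection onto the range of S. *)
exists (fam q T); rewrite gF; split; last by rewrite TS.
  move=> k; rewrite -fam_mul -[LHS]fam1; apply: fam_eq.
  have SF : S *m (1%:M - T *m S) = 0 by rewrite mulmxBr mulmx1 mulmxA STS subrr.
  by rewrite -eS -mulmxA -(mulmxA S S) SF !mulmx0.
by rewrite -mulmxA (mulmxA S) STS.
Qed.

(* [tgm (gram q) (gram p)] is the trace norm of [sum_j p_j (x) q_j^*].  With the
   polar decompositions of [q] and of [p |q|], and with [S], the modulus of
   [p |q|], diagonalised with eigenvalues [d_k], the sum becomes
   [sum_k d_k <x g_k, r_k>] for contractive families [g], [r]. *)
Lemma tgm_gram l (p q : 'I_l -> H) :
  (forall x, contraction x -> `|\sum_j ip (x (p j)) (q j)| <= tgm (gram q) (gram p)) /\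
  exists2 x, contraction x & \sum_j ip (x (p j)) (q j) = tgm (gram q) (gram p).
Proof.
rewrite /tgm; set X := gram q; set Y := gram p.
have [hX eX] := msqrtP (psd_gram q); rewrite -/X in hX eX.
set rX := msqrt X in hX eX *.
have hN : psd (rX *m Y *m rX).
  by rewrite -{1}(psd_herm hX); apply: psd_congr; exact: psd_gram.
have [] := msqrtP hN; set S := msqrt _ => hS eS.
have [r [qr rr rX1]] := polar_fam hX eX.
have gp : S *m S = gram (fam p rX) by rewrite gram_fam psd_herm.
have [g [pg gg gS]] := polar_fam hS gp.
have [V [d [V1 V2 hd eV]]] := psd_spectral hS.
have trS : \tr S = \sum_k d 0 k by rewrite eV mxtrace_mulC mulmxA V1 mul1mx mxtrace_diag.
(* Conjugating the projection [gram f] by the unitary [V] gives a projection again. *)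
have conjproj (f : 'I_l -> H) : gram f *m gram f = gram f -> contractive_fam (fam f V).
  move=> hf; apply: contractive_fam_proj.
  by rewrite gram_fam !mulmxA -(mulmxA _ V) V2 mulmx1 -(mulmxA _ (gram f) (gram f)) hf.
have cg := conjproj g gg; have cr := conjproj r rr.
have key x : is_bop x -> \sum_j ip (x (p j)) (q j) =
    \sum_k d 0 k * ip (x (fam g V k)) (fam r V k).
  (* The factor [rX] passes from [r] to [p], where [fam p rX] is [fam g S]; once S = V D V^* is
     inserted, V^* returns to the side of [r] as V. *)
  move=> hx; under eq_bigr do rewrite qr -{1}(psd_herm hX).
  rewrite -sum_ip_fam //; under eq_bigr do rewrite pg eV fam_mul.
  rewrite sum_ip_fam // trmxCK; apply: eq_bigr => k _.
  rewrite fam_mul {1}/fam (bigD1 k) //= big1 => [|j jk].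
    by rewrite addr0 mxE eqxx mulr1n bopZ // ipZl.
  by rewrite mxE (negPf jk) mulr0n scale0r.
split=> [x hx|].
  rewrite key ?trS; last by case: hx.
  apply: le_trans (ler_norm_sum _ _ _) _; apply: ler_sum => k _.
  rewrite normrM ger0_norm // ler_piMr // cmodE lecR.
  apply: le_trans (cauchy_schwarz _ _) _; rewrite mulr_ile1 ?nrm_ge0 //.
    exact: le_trans (contraction_le hx _) (contractive_fam_nrm _ cg).
  exact: contractive_fam_nrm.
pose x0 z := \sum_k ip z (fam g V k) *: fam r V k.
have hx0 : contraction x0 by exact: contraction_of_fams.
exists x0 => //; rewrite key ?trS; last by case: hx0.
apply: eq_bigr => k _; have [->|dk] := eqVneq (d 0 k) 0; first by rewrite mul0r.
(* If G fixes the range of S^2 and d_k is nonzero, G fixes the k-th eigenvector. Hence [fam g V k]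
   and [fam r V k] are unit vectors orthogonal to the other members of their families, and [x0]
   sends the first to the second. For d_k = 0 the weight kills the term. *)
have eigS (G : 'M[C]_l) : G *m (S *m S) = S *m S -> forall j,
    (V^t* *m G *m V) j k = (j == k)%:R.
  move=> GS j; pose D := diag_mx d *m diag_mx d.
  have eSS : S *m S = V *m D *m V^t*.
    by rewrite eV /D !mulmxA -(mulmxA _ (V^t*) V) V1 mulmx1.
  have : V^t* *m G *m V *m D = D.
    have -> : V^t* *m G *m V *m D = V^t* *m (G *m (V *m D *m V^t*)) *m V.
      by rewrite -!mulmxA V1 mulmx1.
    by rewrite -eSS GS eSS !mulmxA V1 mul1mx -mulmxA V1 mulmx1.
  rewrite /D mulmx_diag => /matrixP /(_ j k); rewrite mul_mx_diag !mxE => h.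
  apply: (mulIf (mulf_neq0 dk dk)); rewrite h.
  by have [->|] := eqVneq j k; rewrite ?mul1r ?mul0r.
have gramE (f : 'I_l -> H) j : ip (fam f V k) (fam f V j) = (V^t* *m gram f *m V) j k.
  by rewrite -gram_fam mxE.
have Sg : gram g *m (S *m S) = S *m S by rewrite mulmxA gS.
have Sr : gram r *m (S *m S) = S *m S by rewrite eS !mulmxA rX1.
rewrite /x0 (bigD1 k) //= gramE eigS // eqxx scale1r big1 ?addr0 => [|j jk].
  by rewrite gramE eigS // eqxx mulr1.
by rewrite gramE eigS // (negPf jk) scale0r.
Qed.

End Families.

(** * Compact operators *)

Section Thinning.
Implicit Types (A B : nat -> Prop) (P Q : nat -> nat -> Prop).

Definition unbounded A := forall N, exists2 n, (N <= n)%N & A n.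

(** Total boundedness at a fixed tolerance, expressed by index sets: in this form finitely many
    conditions are combined without composing subsequences. *)
Definition thinnable P := forall A, unbounded A ->
  exists B, [/\ forall n, B n -> A n, unbounded B &
    forall n m, B n -> B m -> P n m].

Lemma thinnable_mono P Q : (forall n m, P n m -> Q n m) ->
  thinnable P -> thinnable Q.
Proof.
by move=> PQ hP A /hP[B [BA hB PB]]; exists B; split=> // n m ? ?; apply/PQ/PB.
Qed.

Lemma thinnableT P : (forall n m, P n m) -> thinnable P.
Proof. by move=> hP A hA; exists A; split. Qed.

Lemma thinnable_and P Q : thinnable P -> thinnable Q ->
  thinnable (fun n m => P n m /\ Q n m).
Proof.
move=> hP hQ A /hP[B [BA /hQ[D [DB hD QD]] PB]].
exists D; split=> // [n /DB/BA //|n m Dn Dm].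
by split; [apply: PB; apply: DB | apply: QD].
Qed.

Lemma thinnable_seq (T : eqType) (s : seq T) (P : T -> nat -> nat -> Prop) :
  (forall t, thinnable (P t)) ->
  thinnable (fun n m => forall t, t \in s -> P t n m).
Proof.
move=> hP; elim: s => [|t s IH]; first exact: thinnableT.
apply: thinnable_mono (thinnable_and (hP t) IH) => n m [Pt Ps] u.
by rewrite inE => /orP[/eqP -> //|/Ps].
Qed.

Lemma thinnable_ord l (P : 'I_l -> nat -> nat -> Prop) :
  (forall j, thinnable (P j)) -> thinnable (fun n m => forall j, P j n m).
Proof.
move=> hP; apply: thinnable_mono (thinnable_seq (enum 'I_l) hP) => n m h j.
by apply: h; rewrite mem_enum.
Qed.

Lemma unbounded_split A (D : nat -> bool) : unbounded A ->
  exists b, unbounded (fun n => A n /\ D n = b).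
Proof.
move=> hA; have [h|] := classic (unbounded (fun n => A n /\ D n = true)).
  by exists true.
move=> /not_all_ex_not[N hN]; exists false => K.
have [n nNK An] := hA (maxn N K); move: nNK; rewrite geq_max => /andP[nN nK].
exists n => //; split=> //; apply/negP => Dn; apply: hN; exists n => //.
Qed.

(** Bisection: of the two halves of an interval, one contains [h n] for infinitely many of the
    remaining n. *)
Lemma thinnable_bounded (R : realType) (h : nat -> R) (M d : R) : 0 < d ->
  (forall n, `|h n| <= M) -> thinnable (fun n m => `|h n - h m| <= d).
Proof.
move=> d0 hM.
have M0 : 0 <= M by apply: le_trans (normr_ge0 (h 0%N)) (hM _).
have bisect k : forall (c r : R) A, unbounded A -> (forall n, A n -> `|h n - c| <= r) ->
    exists B, [/\ forall n, B n -> A n, unbounded B &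
      exists c', forall n, B n -> `|h n - c'| <= r / 2 ^+ k].
  elim: k => [|k IH] c r A hA hc.
    by exists A; split=> //; exists c => n /hc; rewrite expr0 divr1.
  have [b hb] := unbounded_split (fun n => h n <= c) hA.
  have [c1 hc1] : exists c1, forall n, A n /\ (h n <= c) = b -> `|h n - c1| <= r / 2.
    case: b {hb}; [exists (c - r / 2) | exists (c + r / 2)] => n [/hc hn].
      by move=> hle; move: hn; rewrite !ler_norml; lra.
    by move=> /negbT; rewrite -ltNge => hlt; move: hn; rewrite !ler_norml; lra.
  have [B [BA hB [c' hc']]] := IH c1 (r / 2) _ hb hc1.
  exists B; split=> // [n /BA[]//|]; exists c' => n /hc'.
  by rewrite exprS invfM mulrA.
move=> A hA; pose k := Num.truncn (2 * M / d).
(* After k + 1 halvings the radius M / 2^(k+1) is at most d / 2, since 2 M / d < k + 1 <=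
   2^(k+1). *)
have [|B [BA hB [c hc]]] := bisect k.+1 0 M A hA; first by move=> n _; rewrite subr0.
exists B; split=> // n m /hc hn /hc hm.
have hk : M / 2 ^+ k.+1 <= d / 2.
  have hX : 2 * M / d < 2 ^+ k.+1.
    apply: lt_le_trans (truncnS_gt _) _; rewrite -natrX ler_nat -/k.
    by apply: ltnW; exact: ltn_expl.
  rewrite ler_pdivrMr ?exprn_gt0 //; move: hX; rewrite ltr_pdivrMr //.
  move: (2 ^+ k.+1) => X hX; lra.
have -> : h n - h m = (h n - c) - (h m - c) by ring.
by apply: le_trans (ler_normB _ _) _; lra.
Qed.

Lemma thinnable_cmod (R : realType) (h : nat -> R[i]) (M d : R) : 0 < d ->
  (forall n, cmod (h n) <= M) -> thinnable (fun n m => cmod (h n - h m) <= d).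
Proof.
move=> d0 hM; have d2 : 0 < d / 2 by rewrite divr_gt0.
have absle (z : R[i]) : `|complex.Re z| <= cmod z /\ `|complex.Im z| <= cmod z.
  case: z => u v /=; split; rewrite -sqrtr_sqr ler_wsqrtr //.
    by rewrite lerDl sqr_ge0.
  by rewrite lerDr sqr_ge0.
have lecmod (z : R[i]) : cmod z <= `|complex.Re z| + `|complex.Im z|.
  rewrite -(@ler_pXn2r _ 2) ?nnegrE ?cmod_ge0 ?addr_ge0 //.
  case: z => u v /=; rewrite sqr_sqrtr ?addr_ge0 ?sqr_ge0 // sqrrD.
  rewrite !real_normK ?num_real // addrAC lerDl.
  by rewrite mulrn_wge0 // mulr_ge0.
have h1 := @thinnable_bounded R (fun n => complex.Re (h n)) M _ d2
  (fun n => le_trans (absle _).1 (hM n)).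
have h2 := @thinnable_bounded R (fun n => complex.Im (h n)) M _ d2
  (fun n => le_trans (absle _).2 (hM n)).
apply: thinnable_mono (thinnable_and h1 h2) => n m [].
rewrite -!raddfB /= => r1 r2; apply: le_trans (lecmod _) _.
by move: r1 r2; rewrite !raddfB /=; lra.
Qed.

Lemma thinnable_diagonal (P : nat -> nat -> nat -> Prop) :
  (forall k, thinnable (P k)) ->
  exists phi : nat -> nat, (forall n, (phi n < phi n.+1)%N) /\
    forall k n m, (k <= n)%N -> (k <= m)%N -> P k (phi n) (phi m).
Proof.
move=> hP; pose S := {A | unbounded A}.
have hnext k (A : S) : exists B : S, (forall n, sval B n -> sval A n) /\
    forall n m, sval B n -> sval B m -> P k n m.
  by case: A => A hA; have [B [BA hB PB]] := hP k A hA; exists (exist _ B hB).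
have hT : unbounded (fun=> True) by move=> N; exists N.
pose A0 : S := exist unbounded _ hT.
pose next k (A : S) := epsilon (inhabits A0) (fun B : S =>
  (forall n, sval B n -> sval A n) /\ forall n m, sval B n -> sval B m -> P k n m).
have nextP k (A : S) := epsilon_spec (inhabits A0) _ (hnext k A).
pose chain := fix chain k := if k is k'.+1 then next k' (chain k') else A0.
have chain_sub n k : (k <= n)%N -> forall i, sval (chain n) i -> sval (chain k) i.
  move=> /subnKC <-; elim: (n - k)%N => [|j IH] i; first by rewrite addn0.
  by rewrite addnS => h; apply: IH; exact: ((nextP (k + j)%N (chain (k + j)%N)).1 i h).
have hpick k N : exists n, (N <= n)%N /\ sval (chain k) n.
  by have [n ? ?] := svalP (chain k) N; exists n.
pose pick k N := epsilon (inhabits 0%N) (fun n => (N <= n)%N /\ sval (chain k) n).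
have pickP k N := epsilon_spec (inhabits 0%N) _ (hpick k N).
(* [chain n.+1] is the first set of the chain whose pairs satisfy [P n]; picking [phi n] there makes
   the conclusion for k hold already from index k on. *)
pose phi := fix phi n := pick n.+1 (if n is n'.+1 then (phi n').+1 else 0%N).
exists phi; split=> [n|k n m kn km]; first exact: (pickP n.+2 (phi n).+1).1.
have phiP i : sval (chain i.+1) (phi i) by case: i => [|i]; exact: (pickP _ _).2.
by apply: (nextP k (chain k)).2; apply: (chain_sub _ k.+1 _ _ (phiP _)).
Qed.

End Thinning.

(** * Equivalent forms of compactness *)

Section CompactOperators.
Variables (R : realType) (H : hilbert R).
Implicit Types (x y z : H) (a c : R[i]) (g h : H -> H) (M e : R) (s : seq (H * H)).

Definition finite_rank s x : H := \sum_(p <- s) ip x p.1 *: p.2.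

(** For bounded operators, this predicate and the next two are equivalent to compactness, by a cycle
    of implications: [no_separated_image], [small_on_cofinite], [approximable], [is_compact_op], and
    back. The zero set in [small_on_cofinite] has finite codimension. *)
Definition approximable g := forall e, 0 < e ->
  exists s, forall x, nrm (g x - finite_rank s x) <= e * nrm x.

Definition small_on_cofinite g := forall e, 0 < e ->
  exists s : seq H, forall x, (forall u, u \in s -> ip x u = 0) ->
    nrm (g x) <= e * nrm x.

Definition no_separated_image g := forall e, 0 < e ->
  forall x : nat -> H, (forall n, nrm (x n) <= 1) ->
    exists n m, (n < m)%N /\ nrm (g (x n) - g (x m)) < e.

(* Otherwise unit vectors [x n] orthogonal to [g^* g (x m)] for all [m < n]
   with [|g (x n)| > e] could be chosen inductively, and their images would be
   orthogonal. *)
Lemma small_of_no_separated g : is_bop g -> no_separated_image g ->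
  small_on_cofinite g.
Proof.
move=> hg hS e e0; apply: NNPP => hn.
have hx (s : seq H) : exists x, [/\ nrm x = 1, forall u, u \in s -> ip x u = 0 &
    e < nrm (g x)].
  apply: NNPP => hn2; apply: hn; exists s => x hu; rewrite leNgt; apply/negP => lt.
  have x0 : x != 0.
    by apply/eqP => x0; move: lt; rewrite x0 (bop0 hg) nrm0 mulr0 ltxx.
  apply: hn2; exists ((nrm x)^-1%:C *: x); split; first exact: nrm_normalize.
    by move=> u /hu; rewrite ipZl => ->; rewrite mulr0.
  rewrite (bopZ _ _ hg) nrmZ cmod_real ?invr_ge0 ?nrm_ge0 //.
  by rewrite mulrC ltr_pdivlMr ?nrm_gt0.
pose F (s : seq H) := epsilon (inhabits (0 : H)) (fun x =>
  [/\ nrm x = 1, forall u, u \in s -> ip x u = 0 & e < nrm (g x)]).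
have FP (s : seq H) := epsilon_spec (inhabits (0 : H)) _ (hx s).
pose L := fix L n := if n is n'.+1 then adj g (g (F (L n'))) :: L n' else [::].
have memL n m : (n < m)%N -> adj g (g (F (L n))) \in L m.
  elim: m => // m IH; rewrite ltnS leq_eqVlt inE => /orP[/eqP -> |/IH ->].
    by rewrite eqxx.
  by rewrite orbT.
have [n|n [m [nm]]] := hS e e0 (fun n => F (L n)); first by case: (FP (L n)) => ->.
have [_ _ hn'] := FP (L n); have [_ /(_ _ (memL _ _ nm)) h0 hm'] := FP (L m).
rewrite -/(F _) in hn' h0 hm'.
rewrite nrmB; apply/negP; rewrite -leNgt -(@ler_pXn2r _ 2) ?nnegrE ?nrm_ge0 ?(ltW e0) //.
rewrite nrm2D nrmN ipNr adjP // h0 oppr0 /= mul0rn addr0.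
apply: (@le_trans _ _ (nrm (g (F (L m))) ^+ 2)); last by rewrite lerDl sqr_ge0.
by rewrite ler_pXn2r ?nnegrE ?nrm_ge0 ?(ltW e0) ?ltW.
Qed.

(** The list [w] carries the orthogonal projection onto the span of [s]. Each vector of [s]
    contributes its normalised residual, or nothing if the residual vanishes. *)
Lemma gram_schmidt (s : seq H) : exists w : seq H,
  (forall x v, v \in w -> ip (x - \sum_(v <- w) ip x v *: v) v = 0) /\
  forall u, u \in s -> \sum_(v <- w) ip u v *: v = u.
Proof.
elim: s => [|u s [w [hw hs]]]; first by exists [::].
pose P (w' : seq H) x := \sum_(v <- w') ip x v *: v.
pose u' := u - P w u.
have hu' v : v \in w -> ip u' v = 0 by exact: hw.
have [u0|u0] := eqVneq u' 0.
  exists w; split=> // z; rewrite inE => /orP[/eqP ->|/hs //].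
  by apply/eqP; rewrite eq_sym -subr_eq0 -/(P w u) -/u' u0.
pose v0 := (nrm u')^-1%:C *: u'.
have nv0 : ip v0 v0 = 1 by rewrite ipxx nrm_normalize // expr1n.
have hv0 v : v \in w -> ip v0 v = 0 by move=> /hu' h; rewrite ipZl h mulr0.
have hv0' v : v \in w -> ip v v0 = 0 by move=> /hv0 h; rewrite hinnerC h conjc0.
have Pv0 x : ip (P w x) v0 = 0.
  by rewrite ip_suml big_seq big1 // => v /hv0' h; rewrite ipZl h mulr0.
exists (v0 :: w); split=> [x v|z]; rewrite !inE big_cons -/(P w _).
  rewrite [_ + P w x]addrC opprD addrA => /orP[/eqP ->|vw]; rewrite ipBl ipZl.
    by rewrite nv0 mulr1 ipBl Pv0 subr0 subrr.
  by rewrite hv0 // mulr0 subr0; exact: hw.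
move=> /orP[/eqP ->|/hs zs]; last first.
  by rewrite [P w z]zs -[in ip z v0]zs Pv0 scale0r add0r.
have -> : ip u v0 = (nrm u')%:C.
  rewrite -[u](subrK (P w u)) ipDl -/u' Pv0 addr0 ipZr conjc_real ipxx.
  by rewrite -rmorphM /= expr2 mulKf ?nrm_eq0.
rewrite scalerA -rmorphM /= mulfV ?nrm_eq0 // scale1r; exact: subrK.
Qed.

Lemma orthogonal_projection (s : seq H) : exists t : seq (H * H), forall x,
  (forall u, u \in s -> ip (x - finite_rank t x) u = 0) /\
  nrm (x - finite_rank t x) <= nrm x.
Proof.
have [w [hw hs]] := gram_schmidt s; exists [seq (v, v) | v <- w] => x.
rewrite /finite_rank big_map /=; set y := \sum_(v <- w) _.
have hperp z : ip (x - y) (\sum_(v <- w) ip z v *: v) = 0.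
  rewrite ip_sumr big_seq big1 // => v vw.
  by rewrite ipZr (hw x v vw) mulr0.
split=> [u /hs <-|]; first exact: hperp.
rewrite -(@ler_pXn2r _ 2) ?nnegrE ?nrm_ge0 // -[in leRHS](subrK y x) (nrm2D (x - y) y).
have -> : ip (x - y) y = 0 := hperp x.
by rewrite /= mul0rn addr0 lerDl sqr_ge0.
Qed.


(** With P the projection onto the span of [s], g P has finite rank, and g - g P = g (1 - P) is
    small because 1 - P is a contraction onto vectors orthogonal to [s]. *)
Lemma approximable_of_small g : is_bop g -> small_on_cofinite g -> approximable g.
Proof.
move=> hg hW e e0; have [s hs] := hW e e0; have [t ht] := orthogonal_projection s.
exists [seq (p.1, g p.2) | p <- t] => x; have [h1 h2] := ht x.
have -> : g x - finite_rank [seq (p.1, g p.2) | p <- t] x = g (x - finite_rank t x).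
  rewrite (bopB _ _ hg) /finite_rank big_map (bop_sum _ _ _ hg); congr (_ - _).
  by apply: eq_bigr => p _; rewrite (bopZ _ _ hg).
by apply: le_trans (hs _ h1) _; rewrite ler_wpM2l // ltW.
Qed.

Lemma approximable_axpy a g h : approximable g -> approximable h ->
  approximable (fun x => a *: g x + h x).
Proof.
move=> hg hh e e0; have c0 := cmod_ge0 a.
have d0 : 0 < cmod a + 1 by rewrite ltr_wpDl.
have [|s hs] := hg (e / (cmod a + 1) / 2); first by rewrite !divr_gt0.
have [|t ht] := hh (e / 2); first by rewrite divr_gt0.
exists ([seq (p.1, a *: p.2) | p <- s] ++ t) => x.
rewrite /finite_rank big_cat big_map /=.
have -> : \sum_(p <- s) ip x p.1 *: (a *: p.2) = a *: finite_rank s x.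
  by rewrite scaler_sumr; apply: eq_bigr => p _; rewrite !scalerA mulrC.
rewrite opprD addrACA -scalerBr; apply: le_trans (nrmD _ _) _; rewrite nrmZ.
have -> : e * nrm x = e / 2 * nrm x + e / 2 * nrm x by rewrite -mulrDl -splitr.
apply: lerD (ht x); apply: (@le_trans _ _ (cmod a * (e / (cmod a + 1) / 2 * nrm x))).
  by rewrite ler_wpM2l.
rewrite mulrA ler_wpM2r ?nrm_ge0 //.
have -> : cmod a * (e / (cmod a + 1) / 2) = e / 2 * (cmod a / (cmod a + 1)).
  by field; rewrite gt_eqF.
by rewrite ler_piMr ?divr_ge0 ?(ltW e0) // ler_pdivrMr // mul1r lerDl.
Qed.

Lemma approximable0 : approximable (fun=> 0 : H).
Proof.
move=> e e0; exists [::] => x; rewrite /finite_rank big_nil subr0 nrm0.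
by rewrite mulr_ge0 ?nrm_ge0 // ltW.
Qed.

Lemma approximable_ext g h : g =1 h -> approximable g -> approximable h.
Proof.
by move=> gh hg e /hg[s hs]; exists s => x; rewrite -gh.
Qed.

(** The adjoint of a finite rank operator swaps the two vectors of each pair, and the adjoint of the
    error has the same bound, as in [nrm_adj]. *)
Lemma approximable_adj g : is_bop g -> approximable g -> approximable (adj g).
Proof.
move=> hg hA e e0; have [s hs] := hA e e0; exists [seq (p.2, p.1) | p <- s] => y.
set z := _ - _.
have hz x : ip x z = ip (g x - finite_rank s x) y.
  rewrite ipBr ipBl adjP // /finite_rank big_map ip_sumr ip_suml.
  congr (_ - _); apply: eq_bigr => p _ /=.
  by rewrite ipZr ipZl -hinnerC mulrC.
apply: sqr_le_mul_cancel; rewrite ?mulr_ge0 ?nrm_ge0 ?(ltW e0) //.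
rewrite nrm2 hz; apply: le_trans (Re_le_cmod _) _.
apply: le_trans (cauchy_schwarz _ _) _.
by rewrite mulrAC ler_wpM2r ?nrm_ge0.
Qed.

Lemma nrm_finite_rank s x d :
  (forall p, p \in s -> cmod (ip x p.1) <= d) ->
  nrm (finite_rank s x) <= d * \sum_(p <- s) nrm p.2.
Proof.
move=> h; apply: le_trans (nrm_sum _ _ _) _; rewrite mulr_sumr big_seq [leRHS]big_seq.
by apply: ler_sum => p ps; rewrite nrmZ ler_wpM2r ?nrm_ge0 ?h.
Qed.

(* Hence [g] is weak-to-norm continuous on balls. *)
Lemma approximable_small g M : approximable g -> 0 <= M -> forall e, 0 < e ->
  exists (s : seq H) (d : R), 0 < d /\ forall x, nrm x <= M ->
    (forall u, u \in s -> cmod (ip x u) <= d) -> nrm (g x) <= e.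
Proof.
move=> hg M0 e e0; have M1 : 0 < M + 1 by rewrite ltr_wpDl.
have [|s hs] := hg (e / (M + 1) / 2); first by rewrite !divr_gt0.
pose K := \sum_(p <- s) nrm p.2.
have K0 : 0 <= K by apply: sumr_ge0 => p _; exact: nrm_ge0.
have K1 : 0 < K + 1 by rewrite ltr_wpDl.
exists (map fst s), (e / (K + 1) / 2); split; first by rewrite !divr_gt0.
move=> x hx hu; rewrite -[g x](subrK (finite_rank s x)).
apply: le_trans (nrmD _ _) _; rewrite [e]splitr; apply: lerD.
  apply: le_trans (hs x) _; rewrite mulrAC ler_wpM2r ?invr_ge0 //.
  rewrite mulrAC ler_pdivrMr // ler_wpM2l ?(ltW e0) //.
  by apply: le_trans hx _; rewrite lerDl.
apply: le_trans (@nrm_finite_rank s x (e / (K + 1) / 2) _) _.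
  by move=> p ps; apply: hu; apply: map_f.
rewrite mulrAC ler_wpM2r ?invr_ge0 // mulrAC ler_pdivrMr // ler_wpM2l ?(ltW e0) //.
by rewrite lerDl.
Qed.

(** Weak-to-norm continuity reduces the claim to finitely many scalar sequences [ip (z n) u],
    bounded by Cauchy-Schwarz. *)
Lemma approximable_thinnable g (z : nat -> H) M e : is_bop g -> approximable g ->
  (forall n, nrm (z n) <= M) -> 0 < e ->
  thinnable (fun n m => nrm (g (z n) - g (z m)) <= e).
Proof.
move=> hg hA hz e0; have M0 : 0 <= M := le_trans (nrm_ge0 _) (hz 0%N).
have [||s [d [d0 hs]]] := @approximable_small g (M + M) hA _ e; rewrite ?addr_ge0 //.
have hthin (u : H) : thinnable (fun n m => cmod (ip (z n) u - ip (z m) u) <= d).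
  apply: (thinnable_cmod (M := M * nrm u)) => // n.
  by apply: le_trans (cauchy_schwarz _ _) _; rewrite ler_wpM2r ?nrm_ge0.
apply: thinnable_mono (thinnable_seq s hthin) => n m h.
rewrite -(bopB _ _ hg); apply: hs => [|u us]; last by rewrite ipBl; exact: h.
by apply: le_trans (nrmD _ _) _; rewrite nrmN lerD.
Qed.

Lemma approximable_compact g : is_bop g -> approximable g -> is_compact_op g.
Proof.
move=> hg hA; split=> // x hx.
have hx1 n : nrm (x n) <= 1 by have := hx n; rewrite hnormE lecR.
have [phi [hphi Pphi]] := thinnable_diagonal (fun k =>
  @approximable_thinnable g x 1 k.+1%:R^-1 hg hA hx1 (inv_succ_gt0 R k)).
have [|y hy] := @hilbert_complete R H (fun n => g (x (phi n))).
  move=> e /inv_succ_lt[N hN]; exists N => m n mN nN.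
  by apply: le_lt_trans (hN N (leqnn N)); exact: Pphi.
exists phi, y; split=> // _ /posC_real[e /hy[N hN] ->]; exists N => n /hN.
by rewrite hnormE ltcR.
Qed.

Lemma compact_no_separated g : is_compact_op g -> no_separated_image g.
Proof.
move=> [hg hc] e e0 x hx.
have [|phi [y [hphi hy]]] := hc x; first by move=> n; rewrite hnormE lecR.
have [|N hN] := hy (e / 2)%:C; first by rewrite ltcR divr_gt0.
exists (phi N), (phi N.+1); split; first exact: hphi.
have := hN N (leqnn N); have := hN N.+1 (leqnSn N); rewrite !hnormE !ltcR => h1 h2.
apply: le_lt_trans (nrm_triangle _ y _) _; rewrite (nrmB y) [e]splitr.
exact: ltrD.
Qed.

Lemma approximable_of_no_separated g : is_bop g -> no_separated_image g ->
  approximable g.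
Proof.
by move=> hg h; apply: approximable_of_small => //; exact: small_of_no_separated.
Qed.

Lemma is_compact_opP g : is_compact_op g <-> is_bop g /\ approximable g.
Proof.
split=> [h|[hg hA]]; last exact: approximable_compact.
have hg : is_bop g by case: h.
by split=> //; apply: approximable_of_no_separated; last exact: compact_no_separated.
Qed.

Lemma approximable_of_adj g : is_bop g -> approximable (adj g) -> approximable g.
Proof.
move=> hg h; apply: approximable_ext (approximable_adj (is_bop_adj hg) h) => x.
by apply: ip_ext => z; rewrite -adjP ?adjPr //; exact: is_bop_adj.
Qed.

End CompactOperators.

(** * Elementary operators *)

Section LinearIndependence.
Variables (R : realType) (H : hilbert R).
Local Notation C := R[i].

(** A subspace with zero annihilator is everything. Rows from [S] are collected while their rank is
    below l: a nonzero column of the cokernel is killed by all rows so far but not by some v in [S],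
    and adding v raises the rank. *)
Lemma separated_span (K : fieldType) l (S : 'rV[K]_l -> Prop) : S 0 ->
  (forall c u v, S u -> S v -> S (c *: u + v)) ->
  (forall k : 'cV_l, (forall v, S v -> v *m k = 0) -> k = 0) ->
  forall v, S v.
Proof.
move=> S0 SL Sk.
have hrank r : (r <= l)%N -> exists m (A : 'M[K]_(m, l)),
    (forall i, S (row i A)) /\ (r <= \rank A)%N.
  elim: r => [|r IH] rl; first by exists 0%N, 0; split=> [[]|].
  have [m [A [hA rA]]] := IH (ltnW rl).
  have [rA'|rA'] := ltnP r (\rank A); first by exists m, A.
  have [j hj] : exists j, col j (cokermx A) != 0.
    apply: NNPP => hn; have : \rank (cokermx A) = 0%N.
      apply/eqP; rewrite mxrank_eq0; apply/eqP/matrixP => i j; rewrite mxE.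
      have /negPn/eqP/matrixP/(_ i 0) : ~~ (col j (cokermx A) != 0).
        by apply/negP => h; apply: hn; exists j.
      by rewrite !mxE.
    by rewrite mxrank_coker => /eqP; rewrite subn_eq0 leqNgt (leq_ltn_trans rA').
  have [v [Sv vk]] : exists v, S v /\ v *m col j (cokermx A) != 0.
    apply: NNPP => hn; move/eqP: hj; apply; apply: Sk => v Sv.
    by apply/eqP/negPn/negP => h; apply: hn; exists v.
  exists (m + 1)%N, (col_mx A v); split=> [i|].
    case: (split_ordP i) => i' ->; first by rewrite rowKu.
    by rewrite rowKd row_id.
  apply: leq_ltn_trans rA _; apply: rank_ltmx; rewrite ltmxE; apply/andP; split.
    by rewrite -addsmxE addsmxSl.
  apply/negP; rewrite col_mx_sub => /andP[_ /submxP[D eD]].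
  by move: vk; rewrite eD -mulmxA colE (mulmxA A) mulmx_coker mul0mx mulmx0 eqxx.
have [m [A [hA rA]]] := hrank l (leqnn l); move=> v.
have /submxP[D ->] : (v <= A)%MS by apply: submx_full; rewrite /row_full eqn_leq rank_leq_col.
rewrite mulmx_sum_row; elim/big_rec: _ => // i u _ Su; exact: SL.
Qed.

Lemma scale_into_ball (z : H) : exists2 t : C, t != 0 & nrm (t *: z) <= 1.
Proof.
have z1 : 0 < 1 + nrm z by rewrite ltr_pwDl ?nrm_ge0.
exists ((1 + nrm z)^-1)%:C.
  by rewrite fmorph_eq0 invr_eq0 gt_eqF.
rewrite nrmZ cmod_real ?invr_ge0 ?(ltW z1) // mulrC ler_pdivrMr // mul1r.
by rewrite lerDr.
Qed.

(** Taking [xi] proportional to the sum of the k_j c_j w makes the hypothesis say that this sum has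
    norm 0; scaling keeps both test vectors in the unit ball. *)
Lemma lin_indep_separated l (c : 'I_l -> H -> H) (k : 'I_l -> C) :
  (forall j, is_bop (c j)) -> lin_indep c ->
  (forall w xi : H, nrm w <= 1 -> nrm xi <= 1 ->
     \sum_j k j * ip (c j w) xi = 0) -> forall j, k j = 0.
Proof.
move=> hc hind h; apply: hind => z.
have [t t0 ht] := scale_into_ball z.
pose y := \sum_j k j *: c j (t *: z).
have [t' t'0 ht'] := scale_into_ball y.
have := h (t *: z) (t' *: y) ht ht'.
have -> : \sum_j k j * ip (c j (t *: z)) (t' *: y) = ip y (t' *: y).
  by rewrite ip_suml; apply: eq_bigr => j _; rewrite ipZl.
rewrite ipZr => /eqP; rewrite mulf_eq0 conjc_eq0 (negPf t'0) /= => /eqP/hinner_eq0.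
have -> : y = t *: \sum_j k j *: c j z.
  rewrite scaler_sumr; apply: eq_bigr => j _.
  by rewrite (bopZ _ _ (hc j)) !scalerA mulrC.
by move=> /eqP; rewrite scaler_eq0 (negPf t0) /= => /eqP.
Qed.

(** The vectors v for which the combination of the g_i with coefficients v_i is approximable form a
    subspace. It contains the separating vectors (<c_i w, xi>)_i, hence also the basis vectors. *)
Lemma approximable_separated l (c g : 'I_l -> H -> H) :
  (forall j, is_bop (c j)) -> lin_indep c ->
  (forall w xi : H, nrm w <= 1 -> nrm xi <= 1 ->
     approximable (fun x => \sum_j ip (c j w) xi *: g j x)) ->
  forall j, approximable (g j).
Proof.
move=> hc hind h j.
pose S (v : 'rV[C]_l) := approximable (fun x => \sum_i v 0 i *: g i x).
have /(_ (delta_mx 0 j)) : forall v, S v.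
  apply: separated_span => [|a u v Su Sv|k hk].
  - apply: approximable_ext (@approximable0 _ H) => x; rewrite big1 // => i _.
    by rewrite mxE scale0r.
  - apply: approximable_ext (approximable_axpy a Su Sv) => x.
    rewrite scaler_sumr -big_split; apply: eq_bigr => i _ /=.
    by rewrite !mxE scalerDl scalerA.
  apply/colP => i; rewrite mxE; move: i.
  apply: (lin_indep_separated hc hind) => w xi hw hxi.
  have hS : S (\row_i ip (c i w) xi).
    by apply: approximable_ext (h w xi hw hxi) => x; apply: eq_bigr => i _; rewrite mxE.
  have := hk _ hS; have -> : (\row_i ip (c i w) xi) *m k = (\sum_i k i 0 * ip (c i w) xi)%:M.
    apply/matrixP => i i'; rewrite !ord1 !mxE mulr1n; apply: eq_bigr => m _.
    by rewrite mxE mulrC.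
  by move=> /matrixP/(_ 0 0); rewrite !mxE mulr1n.
apply: approximable_ext => x; rewrite (bigD1 j) //= mxE !eqxx scale1r big1 ?addr0 //.
by move=> i ij; rewrite mxE (negPf ij) andbF scale0r.
Qed.

Lemma lin_dependent l (c : 'I_l.+1 -> H -> H) : ~ lin_indep c ->
  exists (j : 'I_l.+1) (m : 'I_l -> C),
    forall z, c j z = \sum_i m i *: c (lift j i) z.
Proof.
move=> /not_all_ex_not[k hk0]; have [hk hj] := imply_to_and _ _ hk0.
have [j kj] := not_all_ex_not _ _ hj.
exists j, (fun i => - (k j)^-1 * k (lift j i)) => z.
have := hk z; rewrite (bigD1_ord j) //= => /eqP; rewrite addr_eq0 => /eqP h.
have kj0 : k j != 0 by apply/eqP.
apply: (scalerI kj0); rewrite h scaler_sumr -sumrN; apply: eq_bigr => i _.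
by rewrite !scalerA mulrA mulrN mulfV // mulN1r scaleNr.
Qed.

(** If a_j is the sum of the m_i a_i over i other than j, the j-th term is absorbed by replacing b_i
    with b_i + m_i b_j; a dependence among the b_i is treated symmetrically. Each step shortens both
    families by one. *)
Lemma Tmap_lin_indep l (a b : 'I_l -> H -> H) :
  (forall j, is_bop (a j)) -> (forall j, is_bop (b j)) ->
  exists l' (a' b' : 'I_l' -> H -> H),
    [/\ forall j, is_bop (a' j), forall j, is_bop (b' j), lin_indep a',
      lin_indep b' & forall x, is_bop x -> Tmap a b x =1 Tmap a' b' x].
Proof.
elim: l a b => [|l IH] a b ha hb; first by exists 0%N, a, b; split=> // k _ [].
have [ia|/lin_dependent[j [m hm]]] := classic (lin_indep a); last first.
  have [||l' [a' [b' [ha' hb' ia' ib' hT]]]] := IH (fun i => a (lift j i))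
    (fun i z => m i *: b j z + b (lift j i) z).
  - by move=> i.
  - by move=> i; apply: is_bop_axpy.
  exists l', a', b'; split=> // x hx z; rewrite -hT // /Tmap (bigD1_ord j) //= hm.
  rewrite -big_split; apply: eq_bigr => i _ /=.
  by rewrite (is_bop_lin hx) (is_bop_lin (ha _)).
have [ib|/lin_dependent[j [m hm]]] := classic (lin_indep b).
  by exists l.+1, a, b.
have [||l' [a' [b' [ha' hb' ia' ib' hT]]]] := IH
  (fun i z => m i *: a j z + a (lift j i) z) (fun i => b (lift j i)).
- by move=> i; apply: is_bop_axpy.
- by move=> i.
exists l', a', b'; split=> // x hx z; rewrite -hT // /Tmap (bigD1_ord j) //= hm.
rewrite (bop_sum _ _ _ hx) (bop_sum _ _ _ (ha j)) -big_split; apply: eq_bigr => i _ /=.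
by rewrite (bopZ _ _ hx) (bopZ _ _ (ha j)).
Qed.

End LinearIndependence.

(** * Necessity: rank-one tests of compactness and of weak continuity *)

Section ElementaryOperator.
Variables (R : realType) (H : hilbert R).
Implicit Types (x y z xi eta w u : H) (e M : R).

(** This is [tgm_gram] for p_j = b_j eta and q_j = a_j^* xi. Attainment lets a maximiser for one
    value of f_T be inserted in the upper bound for another. *)
Lemma fT_sup l (a b : 'I_l -> H -> H) : (forall j, is_bop (a j)) ->
  forall xi eta, exists r : R, [/\ fT a b xi eta = r%:C,
    forall X, contraction X -> cmod (ip (Tmap a b X eta) xi) <= r &
    exists2 X, contraction X & ip (Tmap a b X eta) xi = r%:C].
Proof.
move=> ha xi eta.
have [hU [X hX hL]] := tgm_gram (fun j => b j eta) (fun j => adj (a j) xi).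
have ipT Y : ip (Tmap a b Y eta) xi = \sum_j ip (Y (b j eta)) (adj (a j) xi).
  by rewrite ip_suml; apply: eq_bigr => j _; rewrite adjP.
rewrite -/(fT a b xi eta) in hU hL.
have f0 : 0 <= fT a b xi eta := le_trans (normr_ge0 _) (hU X hX).
have fE : fT a b xi eta = (complex.Re (fT a b xi eta))%:C.
  by have := ger0_Im f0; case: (fT a b xi eta) => u v /= ->.
exists (complex.Re (fT a b xi eta)); split=> // [Y hY|].
  by rewrite -lecR -fE -cmodE ipT; apply: hU.
by exists X => //; rewrite ipT hL.
Qed.

Lemma fT_congr l l' (a b : 'I_l -> H -> H) (a' b' : 'I_l' -> H -> H) :
  (forall j, is_bop (a j)) -> (forall j, is_bop (a' j)) ->
  (forall X, is_bop X -> Tmap a b X =1 Tmap a' b' X) ->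
  forall xi eta, fT a b xi eta = fT a' b' xi eta.
Proof.
move=> ha ha' hT xi eta.
have [r [-> hU [X hX hL]]] := fT_sup b ha xi eta.
have [r' [-> hU' [X' hX' hL']]] := fT_sup b' ha' xi eta.
have r0 : 0 <= r := le_trans (cmod_ge0 _) (hU X hX).
have r'0 : 0 <= r' := le_trans (cmod_ge0 _) (hU' X' hX').
congr (_%:C); apply/eqP; rewrite eq_le; apply/andP; split.
  by have := hU' X hX; rewrite -hT ?hL ?cmod_real //; case: hX.
by have := hU X' hX'; rewrite hT ?hL' ?cmod_real //; case: hX'.
Qed.

Lemma elem_op_compact_congr l l' (a b : 'I_l -> H -> H) (a' b' : 'I_l' -> H -> H) :
  (forall X, is_bop X -> Tmap a b X =1 Tmap a' b' X) ->
  elem_op_compact a b -> elem_op_compact a' b'.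
Proof.
move=> hT h X hX; have [phi [Y [hphi [hY hc]]]] := h X hX.
exists phi, Y; split=> //; split=> // e /hc[N hN]; exists N => n nN z.
by rewrite -hT; [exact: hN | case: (hX (phi n))].
Qed.

Lemma elem_op_no_separated l (a b : 'I_l -> H -> H) : elem_op_compact a b ->
  forall X : nat -> H -> H, (forall n, contraction (X n)) -> forall e, 0 < e ->
  exists n m, (n < m)%N /\
    forall z, nrm (Tmap a b (X n) z - Tmap a b (X m) z) <= e * nrm z.
Proof.
move=> h X hX e e0; have [phi [Y [hphi [_ hY]]]] := h X hX.
have [|N hN] := hY (e / 2)%:C; first by rewrite ltcR divr_gt0.
exists (phi N), (phi N.+1); split=> // z.
have /opnorm_leE/(_ z) h1 := hN N (leqnn N).
have /opnorm_leE/(_ z) h2 := hN N.+1 (leqnSn N).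
apply: le_trans (nrm_triangle _ (Y z) _) _.
by rewrite (nrmB (Y z)) [e]splitr mulrDl lerD.
Qed.

Lemma Tmap_rank1 l (a b : 'I_l -> H -> H) u w z : (forall j, is_bop (a j)) ->
  Tmap a b (rank1 u w) z = \sum_j ip (b j z) u *: a j w.
Proof. by move=> ha; apply: eq_bigr => j _; rewrite /rank1 (bopZ _ _ (ha j)). Qed.

Lemma ip_Tmap_rank1 l (a b : 'I_l -> H -> H) u w z xi : (forall j, is_bop (a j)) ->
  ip (Tmap a b (rank1 u w) z) xi = ip (\sum_j ip (a j w) xi *: b j z) u.
Proof.
move=> ha; rewrite Tmap_rank1 // !ip_suml; apply: eq_bigr => j _.
by rewrite !ipZl mulrC.
Qed.

Lemma elem_op_compact_left l (a b : 'I_l -> H -> H) eta u :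
  (forall j, is_bop (a j)) -> elem_op_compact a b -> nrm eta <= 1 -> nrm u <= 1 ->
  approximable (fun w => \sum_j ip (b j eta) u *: a j w).
Proof.
move=> ha hT heta hu; apply: approximable_of_no_separated.
  exact: is_bop_comb.
move=> e e0 w hw; have e2 : 0 < e / 2 by rewrite divr_gt0.
have [|n [m [nm h]]] := elem_op_no_separated hT (X := fun n => rank1 u (w n)) _ e2.
  by move=> n; apply: contraction_rank1.
exists n, m; split=> //; have := h eta; rewrite !Tmap_rank1 // => /le_lt_trans; apply.
apply: (@le_lt_trans _ _ (e / 2)); last by rewrite ltr_pdivrMr // ltr_pMr // ltr1n.
by rewrite ler_piMr // ltW.
Qed.

(** Since <B z, u> = <T(rank1 u w) z, xi>, closeness of the images under T of two rank-one operators
    bounds the difference of the vectors B^* u_n; so B^* separates no bounded sequence, and B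
    follows by taking adjoints. *)
Lemma elem_op_compact_right l (a b : 'I_l -> H -> H) w xi :
  (forall j, is_bop (a j)) -> (forall j, is_bop (b j)) ->
  elem_op_compact a b -> nrm w <= 1 -> nrm xi <= 1 ->
  approximable (fun z => \sum_j ip (a j w) xi *: b j z).
Proof.
move=> ha hb hT hw hxi; set B := (fun z => _).
have hB : is_bop B by exact: is_bop_comb.
apply: approximable_of_adj => //.
apply: approximable_of_no_separated; first exact: is_bop_adj.
move=> e e0 u hu; have e2 : 0 < e / 2 by rewrite divr_gt0.
have [|n [m [nm h]]] := elem_op_no_separated hT (X := fun n => rank1 (u n) w) _ e2.
  by move=> n; apply: contraction_rank1.
exists n, m; split=> //; set z := _ - _.
apply: (@le_lt_trans _ _ (e / 2)); last by rewrite ltr_pdivrMr // ltr_pMr // ltr1n.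
apply: sqr_le_mul_cancel; rewrite ?nrm_ge0 ?(ltW e2) //.
rewrite nrm2 /z -(bopB _ _ (is_bop_adj hB)) -adjP // (bopB _ _ (is_bop_adj hB)) -/z.
rewrite ipBr -!ip_Tmap_rank1 // -ipBl.
apply: le_trans (Re_le_cmod _) _; apply: le_trans (cauchy_schwarz _ _) _.
apply: le_trans (h z); by rewrite ler_piMr ?nrm_ge0.
Qed.

Lemma small_on_cofinite_unit (g : H -> H) : is_bop g ->
  (forall e, 0 < e -> exists s : seq H, forall z, nrm z = 1 ->
     (forall u, u \in s -> ip z u = 0) -> nrm (g z) <= e) ->
  small_on_cofinite g.
Proof.
move=> hg h e /h[s hs]; exists s => z hz.
have [->|z0] := eqVneq z 0; first by rewrite (bop0 hg) nrm0 mulr0.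
have := hs _ (nrm_normalize z0); rewrite (bopZ _ _ hg) nrmZ cmod_real ?invr_ge0 ?nrm_ge0 //.
rewrite mulrC ler_pdivrMr ?nrm_gt0 //; apply => u us.
by rewrite ipZl hz // mulr0.
Qed.

Lemma fT0r l (a b : 'I_l -> H -> H) xi : (forall j, is_bop (a j)) ->
  (forall j, is_bop (b j)) -> fT a b xi 0 = 0.
Proof.
move=> ha hb; have [r [-> _ [X [hX _] <-]]] := fT_sup b ha xi 0.
by rewrite /Tmap big1 ?ip0l // => j _; rewrite (bop0 (hb j)) (bop0 hX) (bop0 (ha j)).
Qed.

Lemma fT0l l (a b : 'I_l -> H -> H) eta : (forall j, is_bop (a j)) ->
  fT a b 0 eta = 0.
Proof. by move=> ha; have [r [-> _ [X _ <-]]] := fT_sup b ha 0 eta; rewrite ip0r. Qed.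

(** A unit vector z orthogonal to the vectors [v k] lies in the weak neighbourhood of 0, so f_T(xi,
    z) < e. This bounds |<B z, y>| for all y in the unit ball, hence |B z|. *)
Lemma weak_cont_right l (a b : 'I_l -> H -> H) w xi :
  (forall j, is_bop (a j)) -> (forall j, is_bop (b j)) ->
  weak_cont_at (fT a b) xi 0 -> nrm w <= 1 -> nrm xi <= 1 ->
  approximable (fun z => \sum_j ip (a j w) xi *: b j z).
Proof.
move=> ha hb hf hw hxi; have hB := is_bop_comb (fun j => ip (a j w) xi) hb.
apply: approximable_of_small => //; apply: small_on_cofinite_unit => // e e0.
have [|n [u [v [d [d0 hd]]]]] := hf e%:C; first by rewrite ltcR.
exists (codom v) => z hz1 hz.
have hu k : `|ip (xi - xi) (u k)| < d by rewrite subrr ip0l normr0.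
have hv k : `|ip (z - 0) (v k)| < d by rewrite subr0 hz ?codom_f // normr0.
have := hd xi z _ _ hu hv; rewrite !hnormE hz1 !lecR fT0r // subr0.
move=> /(_ hxi (lexx _)) hlt; apply: nrm_le_dual; first exact: ltW.
move=> y hy; rewrite -ip_Tmap_rank1 //.
have [r [fr hU _]] := fT_sup b ha xi z; apply: le_trans (hU _ (contraction_rank1 hy hw)) _.
move: hlt; rewrite fr cmodE ltcR => /ltW; apply: le_trans.
by rewrite cmod_real // (le_trans (cmod_ge0 _) (hU _ (contraction_rank1 hy hw))).
Qed.

Lemma weak_cont_left l (a b : 'I_l -> H -> H) eta u :
  (forall j, is_bop (a j)) ->
  weak_cont_at (fT a b) 0 eta -> nrm eta <= 1 -> nrm u <= 1 ->
  approximable (fun w => \sum_j ip (b j eta) u *: a j w).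
Proof.
move=> ha hf heta hu; have hA := is_bop_comb (fun j => ip (b j eta) u) ha.
apply: approximable_of_adj => //; have hA' := is_bop_adj hA.
apply: approximable_of_small => //; apply: small_on_cofinite_unit => // e e0.
have [|n [s [v [d [d0 hd]]]]] := hf e%:C; first by rewrite ltcR.
exists (codom s) => z hz1 hz.
have hs k : `|ip (z - 0) (s k)| < d by rewrite subr0 hz ?codom_f // normr0.
have hv k : `|ip (eta - eta) (v k)| < d by rewrite subrr ip0l normr0.
have := hd z eta _ _ hs hv; rewrite !hnormE hz1 !lecR fT0l // subr0.
move=> /(_ (lexx _) heta) hlt; apply: nrm_le_dual; first exact: ltW.
move=> w hw; rewrite hinnerC cmodJ -adjP // -Tmap_rank1 //.
have [r [fr hU _]] := fT_sup b ha z eta; apply: le_trans (hU _ (contraction_rank1 hu hw)) _.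
move: hlt; rewrite fr cmodE ltcR => /ltW; apply: le_trans.
by rewrite cmod_real // (le_trans (cmod_ge0 _) (hU _ (contraction_rank1 hu hw))).
Qed.

End ElementaryOperator.

(** * Sufficiency: compact coefficients *)

Section FromApproximable.
Variables (R : realType) (H : hilbert R).
Implicit Types (x y z xi eta w u : H) (e M : R).

Lemma nrm_small_eq0 z : (forall e, 0 < e -> nrm z <= e) -> z = 0.
Proof.
move=> h; apply/eqP; rewrite -nrm_eq0 eq_le nrm_ge0 andbT.
by apply/ler_addgt0Pr => e e0; rewrite add0r h.
Qed.

Lemma is_bop_uniform_limit (Y : nat -> H -> H) : (forall n, is_bop (Y n)) ->
  (forall e, 0 < e -> exists N, forall n m z, (N <= n)%N -> (N <= m)%N ->
     nrm (Y n z - Y m z) <= e * nrm z) ->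
  exists2 y : H -> H, is_bop y & forall e, 0 < e ->
    exists N, forall n z, (N <= n)%N -> nrm (Y n z - y z) <= e * nrm z.
Proof.
move=> hY hC.
have hlim z : exists y, forall e, 0 < e -> exists N, forall n, (N <= n)%N ->
    nrm (Y n z - y) < e.
  apply: hilbert_complete => e e0; have z1 : 0 < nrm z + 1 by rewrite ltr_wpDl ?nrm_ge0.
  have [|N hN] := hC (e / (nrm z + 1)); first by rewrite divr_gt0.
  exists N => m n mN nN; apply: le_lt_trans (hN _ _ _ mN nN) _.
  by rewrite mulrAC ltr_pdivrMr // ltr_pM2l // ltrDl.
pose y z := epsilon (inhabits (0 : H)) (fun y => forall e, 0 < e ->
  exists N, forall n, (N <= n)%N -> nrm (Y n z - y) < e).
have yP z : forall e, 0 < e -> exists N, forall n, (N <= n)%N -> nrm (Y n z - y z) < e.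
  exact: epsilon_spec (inhabits (0 : H)) _ (hlim z).
have unif e : 0 < e -> exists N, forall n z, (N <= n)%N ->
    nrm (Y n z - y z) <= e * nrm z.
  move=> /hC[N hN]; exists N => n z nN; apply/ler_addgt0Pr => d d0.
  have [K hK] := yP z d d0.
  apply: le_trans (nrm_triangle _ (Y (maxn N K) z) _) _; apply: lerD.
    by apply: hN => //; exact: leq_maxl.
  by apply: ltW; apply: hK; exact: leq_maxr.
exists y => //; have [N hN] := unif 1 ltr01.
have [M M0 hM] := is_bop_bound (hY N).
apply: (is_bopI (M := 1 + M)) => [a u v|z]; last first.
  rewrite -[y z](subrK (Y N z)); apply: le_trans (nrmD _ _) _.
  by rewrite mulrDl lerD // nrmB hN.
apply/eqP; rewrite -subr_eq0; apply/eqP/nrm_small_eq0 => e e0.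
have c1 : 0 < cmod a + 1 by rewrite ltr_wpDl ?cmod_ge0.
(* The total error is e/4 + e/4 + |a| d, and |a| d <= e/2. *)
pose d := e / (cmod a + 1) / 2.
have d0 : 0 < d by rewrite !divr_gt0.
have e4 : 0 < e / 4 by rewrite divr_gt0.
have [N1 h1] := yP (a *: u + v) _ e4; have [N2 h2] := yP u _ d0.
have [N3 h3] := yP v _ e4; pose n := maxn N1 (maxn N2 N3).
have := h1 n (leq_maxl _ _).
have := h2 n (leq_trans (leq_maxl _ _) (leq_maxr _ _)).
have := h3 n (leq_trans (leq_maxr _ _) (leq_maxr _ _)).
rewrite (is_bop_lin (hY n)) => r3 r2 r1.
have -> : y (a *: u + v) - (a *: y u + y v) =
    - (a *: Y n u + Y n v - y (a *: u + v)) + (a *: (Y n u - y u) + (Y n v - y v)).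
  by rewrite scalerBr (addrACA (a *: Y n u)) -opprD opprB addrA subrK.
apply: le_trans (nrmD _ _) _; rewrite nrmN.
have := nrmD (a *: (Y n u - y u)) (Y n v - y v); rewrite nrmZ => r4.
have r5 : cmod a * nrm (Y n u - y u) <= e / 2.
  apply: (@le_trans _ _ ((cmod a + 1) * d)).
    by apply: ler_pM; rewrite ?cmod_ge0 ?nrm_ge0 ?(ltW r2) // lerDl.
  by rewrite /d mulrA mulrCA mulfV ?gt_eqF // mulr1.
lra.
Qed.

(** Once [h] is replaced by a finite rank operator, only the finitely many bounded sequences
    [X n p.2] matter, and [g] makes each of them thinnable. *)
Lemma two_sided_thinnable (g h : H -> H) (X : nat -> H -> H) e :
  is_bop g -> is_bop h -> approximable g -> approximable h ->
  (forall n, contraction (X n)) -> 0 < e ->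
  thinnable (fun n m => forall z, nrm (g (X n (h z)) - g (X m (h z))) <= e * nrm z).
Proof.
move=> hg hh ag ah hX e0.
have [M M0 hM] := is_bop_bound hg; have M1 : 0 < M + 1 by rewrite ltr_wpDl.
(* The difference of two operators g X_n has norm at most 2 M, so this tolerance costs at most
   e/2. *)
have [|s hs] := ah (e / (M + 1) / 4); first by rewrite !divr_gt0.
pose K := \sum_(p <- s) nrm p.1.
have K0 : 0 <= K by apply: sumr_ge0 => p _; exact: nrm_ge0.
have K1 : 0 < K + 1 by rewrite ltr_wpDl.
pose d := e / (K + 1) / 2; have d0 : 0 < d by rewrite !divr_gt0.
have hthin (p : H * H) : thinnable (fun n m => nrm (g (X n p.2) - g (X m p.2)) <= d).
  by apply: (approximable_thinnable (M := nrm p.2)) => // n; exact: contraction_le.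
apply: thinnable_mono (thinnable_seq s hthin) => n m hnm z.
have hXn : is_bop (X n) by case: (hX n).
have hXm : is_bop (X m) by case: (hX m).
pose D y := g (X n y) - g (X m y).
have DD y y' : D (y + y') = D y + D y'.
  by rewrite /D (bopD _ _ hXn) (bopD _ _ hXm) !(bopD _ _ hg) opprD addrACA.
have DZ c y : D (c *: y) = c *: D y.
  by rewrite /D (bopZ _ _ hXn) (bopZ _ _ hXm) !(bopZ _ _ hg) scalerBr.
have D0 : D 0 = 0 by rewrite /D (bop0 hXn) (bop0 hXm) subrr.
have Dle y : nrm (D y) <= 2 * M * nrm y.
  apply: le_trans (nrmD _ _) _; rewrite nrmN.
  have -> : 2 * M * nrm y = M * nrm y + M * nrm y by ring.
  by apply: lerD; apply: le_trans (hM _) _; rewrite ler_wpM2l // contraction_le.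
rewrite -/(D (h z)) -[h z](subrK (finite_rank s z)) DD.
apply: le_trans (nrmD _ _) _; rewrite [e]splitr mulrDl; apply: lerD.
  apply: le_trans (Dle _) _.
  apply: (@le_trans _ _ (2 * (M + 1) * (e / (M + 1) / 4 * nrm z))).
    by apply: ler_pM; rewrite ?mulr_ge0 ?nrm_ge0 // ler_wpM2l // lerDl.
  by rewrite le_eqVlt; apply/orP; left; apply/eqP; field; rewrite gt_eqF.
have -> : D (finite_rank s z) = \sum_(p <- s) ip z p.1 *: D p.2.
  rewrite /finite_rank (big_morph D DD D0); apply: eq_bigr => p _; exact: DZ.
apply: le_trans (nrm_sum _ _ _) _.
apply: (@le_trans _ _ (\sum_(p <- s) nrm z * nrm p.1 * d)).
  rewrite big_seq [leRHS]big_seq; apply: ler_sum => p ps; rewrite nrmZ.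
  by apply: ler_pM; rewrite ?cmod_ge0 ?nrm_ge0 ?cauchy_schwarz //; exact: hnm.
rewrite -mulr_suml -mulr_sumr -/K -mulrA mulrC ler_wpM2r ?nrm_ge0 //.
rewrite /d mulrC mulrAC ler_wpM2r ?invr_ge0 // mulrAC ler_pdivrMr //.
by rewrite ler_wpM2l ?(ltW e0) // lerDl.
Qed.

Lemma elem_op_compact_of_approximable l (a b : 'I_l -> H -> H) :
  (forall j, is_bop (a j)) -> (forall j, is_bop (b j)) ->
  (forall j, approximable (a j)) -> (forall j, approximable (b j)) ->
  elem_op_compact a b.
Proof.
move=> ha hb aa ab X hX.
have hT n : is_bop (Tmap a b (X n)).
  have hXn : is_bop (X n) by case: (hX n).
  have [M M0 hM] := is_bop_bound_fam ha; have [N N0 hN] := is_bop_bound_fam hb.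
  apply: (is_bopI (M := \sum_(j < l) M * N)) => [c y z|z].
    rewrite /Tmap scaler_sumr -big_split; apply: eq_bigr => j _ /=.
    by rewrite (is_bop_lin (hb j)) (is_bop_lin hXn) (is_bop_lin (ha j)).
  rewrite mulr_suml; apply: le_trans (nrm_sum _ _ _) _; apply: ler_sum => j _.
  apply: le_trans (hM _ _) _; rewrite -mulrA ler_wpM2l ?(ltW M0) //.
  exact: le_trans (contraction_le (hX n) _) (hN _ _).
have thin k : thinnable (fun n m => forall z,
    nrm (Tmap a b (X n) z - Tmap a b (X m) z) <= k.+1%:R^-1 * nrm z).
  (* The tolerance is shared among the l terms; dividing by l + 1 covers l = 0. *)
  have e0 : 0 < k.+1%:R^-1 / l.+1%:R :> R by rewrite divr_gt0 ?inv_succ_gt0 ?ltr0n.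
  have hj j := two_sided_thinnable (ha j) (hb j) (aa j) (ab j) hX e0.
  apply: thinnable_mono (thinnable_ord hj) => n m h z.
  rewrite /Tmap -sumrB; apply: le_trans (nrm_sum _ _ _) _.
  apply: le_trans (ler_sum _ (fun j _ => h j z)) _.
  rewrite sumr_const card_ord -[_ *+ l]mulr_natr mulrAC ler_wpM2r ?nrm_ge0 //.
  rewrite -mulrA ler_piMr ?invr_ge0 ?ler0n // mulrC ler_pdivrMr ?ltr0n // mul1r.
  by rewrite ler_nat.
have [phi [hphi Pphi]] := thinnable_diagonal thin.
have [|e /inv_succ_lt[N hN]|Y hY hlim] :=
  @is_bop_uniform_limit (fun n => Tmap a b (X (phi n))).
- by move=> n; exact: hT.
- exists N => n m z nN mN; apply: le_trans (Pphi N n m nN mN z) _.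
  by rewrite ler_wpM2r ?nrm_ge0 // ltW // hN.
exists phi, Y; split=> //; split=> // _ /posC_real[e /hlim[N hN] ->].
by exists N => n nN; apply/opnorm_leE => z; exact: hN.
Qed.

Lemma approximable_small_fam l (g : 'I_l -> H -> H) M :
  (forall j, approximable (g j)) -> 0 <= M -> forall e, 0 < e ->
  exists (s : seq H) (d : R), 0 < d /\ forall z, nrm z <= M ->
    (forall u, u \in s -> cmod (ip z u) <= d) -> forall j, nrm (g j z) <= e.
Proof.
move=> hg M0 e e0; elim: l g hg => [|l IH] g hg.
  by exists [::], 1; split=> // z _ _ [].
have [s [d [d0 hs]]] := IH (fun j => g (lift ord0 j)) (fun j => hg _).
have [t [c [c0 ht]]] := approximable_small (hg ord0) M0 e0.
exists (s ++ t), (Num.min d c); split; first by rewrite lt_min d0 c0.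
move=> z hz hu j; case: (unliftP ord0 j) => [i|] ->.
  by apply: hs => // u us; have := hu u; rewrite mem_cat us le_min => /(_ isT)/andP[].
by apply: ht => // u us; have := hu u; rewrite mem_cat us orbT le_min => /(_ isT)/andP[].
Qed.

(** For one contraction Y, the change of <(T Y) eta, xi> splits for each j into a term in b_j (eta -
    eta0) and a term in a_j^* (xi - xi0), each at most M e. The bound is uniform in Y, so it passes
    to the maxima. *)
Lemma fT_dist l (a b : 'I_l -> H -> H) xi eta xi0 eta0 M e :
  (forall j, is_bop (a j)) -> (forall j, is_bop (b j)) -> 0 <= M ->
  (forall j z, nrm (a j z) <= M * nrm z) -> (forall j z, nrm (b j z) <= M * nrm z) ->
  nrm xi <= 1 -> nrm eta0 <= 1 ->
  (forall j, nrm (adj (a j) (xi - xi0)) <= e) ->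
  (forall j, nrm (b j (eta - eta0)) <= e) ->
  `|fT a b xi eta - fT a b xi0 eta0| <= (2 * M * e * l%:R)%:C.
Proof.
move=> ha hb M0 hMa hMb hxi heta0 hea heb.
have [r [-> hU [X hX hL]]] := fT_sup b ha xi eta.
have [r0 [-> hU0 [X0 hX0 hL0]]] := fT_sup b ha xi0 eta0.
have key Y : contraction Y ->
    cmod (ip (Tmap a b Y eta) xi - ip (Tmap a b Y eta0) xi0) <= 2 * M * e * l%:R.
  move=> hY; have hYb : is_bop Y by case: hY.
  rewrite -lecR -cmodE /Tmap !ip_suml -sumrB.
  apply: le_trans (ler_norm_sum _ _ _) _.
  apply: (@le_trans _ _ (\sum_(j < l) (2 * M * e)%:C)); last first.
    by rewrite sumr_const card_ord mulr_natr rmorphMn.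
  apply: ler_sum => j _; rewrite cmodE lecR.
  have -> : ip (a j (Y (b j eta))) xi - ip (a j (Y (b j eta0))) xi0 =
     ip (a j (Y (b j (eta - eta0)))) xi + ip (Y (b j eta0)) (adj (a j) (xi - xi0)).
    rewrite -adjP // (bopB _ _ (hb j)) (bopB _ _ hYb) (bopB _ _ (ha j)).
    by rewrite ipBl ipBr addrA subrK.
  apply: le_trans (cmodD _ _) _.
  have -> : 2 * M * e = M * e + M * e by ring.
  apply: lerD; apply: le_trans (cauchy_schwarz _ _) _.
    apply: (@le_trans _ _ (nrm (a j (Y (b j (eta - eta0)))))).
      by rewrite ler_piMr ?nrm_ge0.
    apply: le_trans (hMa _ _) _; rewrite ler_wpM2l //.
    exact: le_trans (contraction_le hY _) (heb j).
  apply: ler_pM; rewrite ?nrm_ge0 //.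
  apply: le_trans (contraction_le hY _) _; apply: le_trans (hMb _ _) _.
  by rewrite ler_piMr.
have r_ge0 : 0 <= r := le_trans (cmod_ge0 _) (hU _ hX).
have r0_ge0 : 0 <= r0 := le_trans (cmod_ge0 _) (hU0 _ hX0).
have tri (u v : R[i]) : cmod u <= cmod v + cmod (u - v).
  by apply: le_trans (cmodD _ _); rewrite addrC subrK.
rewrite -rmorphB /= cmodE lecR.
have -> : cmod (r - r0)%:C = `|r - r0| by rewrite /= expr0n addr0 sqrtr_sqr.
set D := 2 * M * e * l%:R.
have le1 : r0 <= r + D.
  have := tri (ip (Tmap a b X0 eta0) xi0) (ip (Tmap a b X0 eta) xi).
  rewrite {1}hL0 cmod_real // -[cmod (_ - _)]cmodN opprB => /le_trans; apply.
  by apply: lerD; [exact: hU | exact: key].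
have le2 : r <= r0 + D.
  have := tri (ip (Tmap a b X eta) xi) (ip (Tmap a b X eta0) xi0).
  rewrite {1}hL cmod_real // => /le_trans; apply.
  by apply: lerD; [exact: hU0 | exact: key].
by rewrite ler_norml; apply/andP; split; move: le1 le2; move: D => D; lra.
Qed.

Lemma weak_cont_of_approximable l (a b : 'I_l -> H -> H) xi0 eta0 :
  (forall j, is_bop (a j)) -> (forall j, is_bop (b j)) ->
  (forall j, approximable (a j)) -> (forall j, approximable (b j)) ->
  nrm xi0 <= 1 -> nrm eta0 <= 1 -> weak_cont_at (fT a b) xi0 eta0.
Proof.
move=> ha hb aa ab hxi0 heta0 _ /posC_real[e e0 ->].
have [M M0 hM] := is_bop_bound_fam ha; have [N N0 hN] := is_bop_bound_fam hb.
pose K := M + N; have K0 : 0 < K by rewrite addr_gt0.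
(* With this choice the bound of [fT_dist] is e l / (l + 1), strictly below e. The radius 2 used
   below bounds differences of vectors of the unit ball. *)
pose e1 := e / (2 * K * l.+1%:R).
have e10 : 0 < e1 by rewrite divr_gt0 // !mulr_gt0 // ltr0n.
have [s [d [d0 hs]]] := approximable_small_fam
  (fun j => approximable_adj (ha j) (aa j)) (ler0n R 2) e10.
have [t [c [c0 ht]]] := approximable_small_fam ab (ler0n R 2) e10.
exists (size (s ++ t)), (fun k => nth 0 (s ++ t) k), (fun k => nth 0 (s ++ t) k).
exists (Num.min d c)%:C; split; first by rewrite ltcR lt_min d0 c0.
move=> xi eta; rewrite !hnormE !lecR => hxi heta hu hv.
have near2 z z0 : nrm z <= 1 -> nrm z0 <= 1 -> nrm (z - z0) <= 2.
  by move=> h1 h2; apply: le_trans (nrmD _ _) _; rewrite nrmN; lra.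
have near_all z : (forall k : 'I_(size (s ++ t)), `|ip z (nth 0 (s ++ t) k)| < (Num.min d c)%:C) ->
    forall u, u \in s ++ t -> cmod (ip z u) <= d /\ cmod (ip z u) <= c.
  move=> h u us; have us' : (index u (s ++ t) < size (s ++ t))%N by rewrite index_mem.
  have := h (Ordinal us'); rewrite /= nth_index // cmodE ltcR => /ltW.
  by rewrite le_min => /andP[].
apply: le_lt_trans (@fT_dist l a b xi eta xi0 eta0 K e1 ha hb (ltW K0) _ _ hxi heta0 _ _) _.
- by move=> j z; apply: le_trans (hM j z) _; rewrite ler_wpM2r ?nrm_ge0 // lerDl ltW.
- by move=> j z; apply: le_trans (hN j z) _; rewrite ler_wpM2r ?nrm_ge0 // lerDr ltW.
- apply: hs; first exact: near2.
  by move=> u us; have [] := near_all _ hu u; rewrite // mem_cat us.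
- apply: ht; first exact: near2.
  by move=> u us; have [] := near_all _ hv u; rewrite // mem_cat us orbT.
rewrite ltcR; have -> : 2 * K * e1 * l%:R = e * (l%:R / l.+1%:R).
  by rewrite /e1; field; rewrite nat1r pnatr_eq0 (gt_eqF K0).
by rewrite gtr_pMr // ltr_pdivrMr ?ltr0n // mul1r ltr_nat.
Qed.

(** Used twice: for independent families representing the same T, which gives (i)-(iii), and for the
    given families when these are independent, which gives (iv). *)
Lemma lin_indep_compact_iff l (a b : 'I_l -> H -> H) :
  (forall j, is_bop (a j)) -> (forall j, is_bop (b j)) ->
  lin_indep a -> lin_indep b ->
  let K := forall j, approximable (a j) /\ approximable (b j) in
  [/\ elem_op_compact a b <-> K,
    K -> forall xi eta, hnorm xi <= 1 -> hnorm eta <= 1 -> weak_cont_at (fT a b) xi eta &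
    (forall xi, hnorm xi <= 1 -> weak_cont_at (fT a b) xi 0) ->
    (forall eta, hnorm eta <= 1 -> weak_cont_at (fT a b) 0 eta) -> K].
Proof.
move=> ha hb ia ib K; split; first split.
- move=> hT j; split; move: j.
    apply: (approximable_separated hb ib) => w xi hw hxi.
    exact: elem_op_compact_left hT hw hxi.
  apply: (approximable_separated ha ia) => w xi hw hxi.
  exact: elem_op_compact_right hT hw hxi.
- by move=> hK; apply: elem_op_compact_of_approximable => // j; case: (hK j).
- move=> hK xi eta; rewrite !hnormE !lecR => hxi heta.
  by apply: weak_cont_of_approximable => // j; case: (hK j).
move=> h1 h2 j; split; move: j.
  apply: (approximable_separated hb ib) => w xi hw hxi.
  by apply: weak_cont_left => //; apply: h2; rewrite hnormE lecR.
apply: (approximable_separated ha ia) => w xi hw hxi.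
by apply: weak_cont_right => //; apply: h1; rewrite hnormE lecR.
Qed.

End FromApproximable.

Theorem theorem1p12 (R : realType) (H : hilbert R) (l : nat)
  (a b : 'I_l -> H -> H)
  (ha : forall j, is_bop (a j)) (hb : forall j, is_bop (b j)) :
  let f := fT a b in
  let cond_i := elem_op_compact a b in
  let cond_ii := forall xi eta : H, hnorm xi <= 1 -> hnorm eta <= 1 ->
                   weak_cont_at f xi eta in
  let cond_iii := (forall xi : H, hnorm xi <= 1 -> weak_cont_at f xi 0) /\
                  (forall eta : H, hnorm eta <= 1 -> weak_cont_at f 0 eta) in
  let cond_iv := forall j, is_compact_op (a j) /\ is_compact_op (b j) in
  (cond_i <-> cond_ii) /\ (cond_ii <-> cond_iii) /\
  (lin_indep a -> lin_indep b -> (cond_i <-> cond_iv)).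
Proof.
move=> f cond_i cond_ii cond_iii cond_iv.
have [l' [a' [b' [ha' hb' ia' ib' hT]]]] := Tmap_lin_indep ha hb.
have [iK Kii iiiK] := lin_indep_compact_iff ha' hb' ia' ib'.
have fE : forall xi eta, f xi eta = fT a' b' xi eta by exact: fT_congr ha ha' hT.
have wcE xi eta : weak_cont_at f xi eta <-> weak_cont_at (fT a' b') xi eta.
  by split=> h e /h[n [u [v [d [d0 hd]]]]]; exists n, u, v, d; split=> // x y ? ? ? ?;
    [rewrite -!fE | rewrite !fE]; exact: hd.
have i'E : cond_i <-> elem_op_compact a' b'.
  split; apply: elem_op_compact_congr => // X hX z; exact/esym/hT.
have i_ii : cond_i -> cond_ii.
  by move=> /i'E/iK/Kii h xi eta hxi heta; apply/wcE/h.
have ii_iii : cond_ii -> cond_iii.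
  move=> h; have n0 : hnorm (0 : H) <= 1 by rewrite hnormE nrm0 lecR.
  by split=> z hz; apply: h.
have iii_i : cond_iii -> cond_i.
  move=> [h1 h2]; apply/i'E/iK/iiiK => z hz; apply/wcE; [exact: h1 | exact: h2].
split; first by split=> [/i_ii | /ii_iii/iii_i].
split; first by split=> [/ii_iii | /iii_i/i_ii].
(* Condition (iv) concerns the given families themselves, so the lemma is now applied to them and
   not to the reduced ones. *)
move=> ia ib; have [iK' _ _] := lin_indep_compact_iff ha hb ia ib.
rewrite /cond_i iK'; split=> h j; have [h1 h2] := h j.
  by split; apply/is_compact_opP.
by move: h1 h2 => /is_compact_opP[_ ?] /is_compact_opP[_ ?].
Qed.
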